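(* Let $\Pi$ be a symmetric node-edge-checkable LCL problem on undirected cycles without input. If $\Pi$ can be solved in $O(\log^* n)$ rounds in the LOCAL model, then there exists an LCL problem $\Pi'$ on undirected cycles with the same asymptotic round complexity as $\Pi$ in the LOCAL model, such that every solution of $\Pi'$ is also a solution of $\Pi$, and $\Pi'$ is $O(1)$-mendable.
   Context: A node-edge-checkable LCL is a tuple $\Pi=(\Gamma,C_{\mathrm{edge}},C_{\mathrm{node}},C_{\mathrm{start}},C_{\mathrm{end}})$ with $\Gamma$ a finite set of labels, $C_{\mathrm{edge}},C_{\mathrm{node}}\subseteq\Gamma\times\Gamma$ and $C_{\mathrm{start}},C_{\mathrm{end}}\subseteq\Gamma$ (the latter only relevant for path endpoints); each node outputs one label per incident edge (half-edge labels), the pair of labels at every degree-2 node must lie in $C_{\mathrm{node}}$, and the pair of labels on the two halves of every edge must lie in $C_{\mathrm{edge}}$. $\Pi$ is symmetric if $C_{\mathrm{start}}=C_{\mathrm{end}}$ and $C_{\mathrm{edge}}$, $C_{\mathrm{node}}$ are symmetric relations. In general, an LCL problem is given by finite label sets and a verifier $\psi$ of constant radius $r$ whose verdict (happy/unhappy) at a node depends only on its labeled radius-$r$ neighborhood; a solution makes $\psi$ happy everywhere. For partial labelings with empty label $\bot$, the relaxed verifier $\psi^*$ is happy at $v$ if some node within distance $r$ of $v$ has label $\bot$, and otherwise agrees with $\psi$ on any completion. A $t$-mend of a $\psi^*$-accepted partial labeling $\lambda$ at $v$ is a $\psi^*$-accepted partial labeling $\mu$ with $\mu(v)\neq\bot$,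 $\mu(u)=\bot\Rightarrow\lambda(u)=\bot$, and $\mu(u)\neq\lambda(u)\Rightarrow\mathrm{dist}(u,v)\le t$. $\Pi'$ is $O(1)$-mendable if some radius-$r$ verifier for $\Pi'$ (accepting exactly its solutions) admits a constant $t$ such that on every graph of the family, for every $\psi^*$-accepted partial labeling and every node $v$, a $t$-mend at $v$ exists. LOCAL model: nodes with unique identifiers communicate along edges in synchronous rounds with unbounded messages; round complexity is the number of rounds needed to output a valid solution. *)

(* Defs.v *)
From mathcomp Require Import all_boot.
Set Implicit Arguments. Unset Strict Implicit. Unset Printing Implicit Defensive.

(* The n-cycle (n >= 3) has node set 'I_n, node v adjacent to v+1 and v-1 (mod n).
   Half-edge outputs of node v are a function  bool -> label:
   [false] = half-edge of v on the edge {v-1,v}, [true] = on the edge {v,v+1}. *)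

Lemma ord_pos n (v : 'I_n) : 0 < n.
Proof. exact: leq_ltn_trans (leq0n v) (ltn_ord v). Qed.

Definition cyc n (v : 'I_n) (k r : nat) : 'I_n :=
  Ordinal (@ltn_pmod (v + k + n * r - r) n (ord_pos v)).

Definition cdist n (u v : 'I_n) : nat :=
  minn ((u + n - v) %% n) ((v + n - u) %% n).

Definition view n (X : Type) (r : nat) (lam : 'I_n -> X) (v : 'I_n)
  : 'I_r.*2.+1 -> X := fun k => lam (cyc v k r).
Arguments view {n X} r lam v.

(* if the cycle is small (n <= 2r+1) the radius-r ball is the whole cycle,
   and the verifier may see its length *)
Definition smallinfo (n r : nat) : option nat :=
  if n <= r.*2.+1 then Some n else None.

Record NELCL := {
  gam : finType;
  cedge : rel gam;
  cnode : rel gam;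
  cstart : pred gam;
  cend : pred gam }.
Arguments cedge : clear implicits.
Arguments cnode : clear implicits.
Arguments cstart : clear implicits.
Arguments cend : clear implicits.

Definition symmetricNE (P : NELCL) : Prop :=
  (forall x y, cedge P x y = cedge P y x) /\
  (forall x y, cnode P x y = cnode P y x) /\
  (forall x, cstart P x = cend P x).

(* solutions on the n-cycle (no endpoints, so C_start/C_end are irrelevant) *)
Definition NEsol (P : NELCL) (n : nat) (lam : 'I_n -> bool -> gam P) : Prop :=
  forall v : 'I_n,
    cnode P (lam v false) (lam v true) && cedge P (lam v true) (lam (cyc v 1 0) false).
Arguments NEsol : clear implicits.

Definition reflectL (S : Type) r (f : 'I_r.*2.+1 -> bool -> S) : 'I_r.*2.+1 -> bool -> S :=
  fun k b => f (rev_ord k) (~~ b).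

Record LCL (S : finType) := {
  rad : nat;
  psi : ('I_rad.*2.+1 -> bool -> S) -> option nat -> bool;
  (* undirected: the verdict does not depend on the orientation of the view *)
  psi_refl : forall f o, psi (reflectL f) o = psi f o }.
Arguments rad {S}.
Arguments psi {S}.

Definition LCLsol (S : finType) (P : LCL S) (n : nat) (lam : 'I_n -> bool -> S) : Prop :=
  forall v : 'I_n, psi P (view (rad P) lam v) (smallinfo n (rad P)).
Arguments LCLsol {S} P n lam.

(* None plays the role of the empty label ⊥ *)
Definition psistar (S : finType) (P : LCL S) (n : nat)
  (lam : 'I_n -> option (bool -> S)) (v : 'I_n) : Prop :=
  forall f : 'I_((rad P).*2.+1) -> bool -> S,
    (forall k : 'I_((rad P).*2.+1), lam (cyc v k (rad P)) = Some (f k)) ->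
    psi P f (smallinfo n (rad P)).

Definition accepted (S : finType) (P : LCL S) n (lam : 'I_n -> option (bool -> S)) : Prop :=
  forall v, psistar P lam v.
Arguments accepted {S} P {n} lam.

Definition is_mend (S : finType) (P : LCL S) n (t : nat)
  (lam : 'I_n -> option (bool -> S)) (v : 'I_n) (mu : 'I_n -> option (bool -> S)) : Prop :=
  [/\ accepted P mu, mu v <> None,
      (forall u, mu u = None -> lam u = None) &
      (forall u, mu u <> lam u -> cdist u v <= t)].
Arguments is_mend {S} P {n} t lam v mu.

Definition O1_mendable (S : finType) (P : LCL S) : Prop :=
  exists P' : LCL S,
    (forall n, 3 <= n -> forall lam, LCLsol P' n lam <-> LCLsol P n lam) /\
    exists t : nat, forall n, 3 <= n -> forall lam : 'I_n -> option (bool -> S),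
      accepted P' lam -> forall v, exists mu, is_mend P' t lam v mu.

(* A T-round algorithm: node v of the n-cycle (n known) outputs its half-edge
   labels as a function of the identifiers in its radius-(T n) ball, seen along
   the walk v-T..v+T; since the cycle is unoriented the output must be
   equivariant under reflection. *)
Record Alg (S : Type) (T : nat -> nat) := {
  run : forall n : nat, ('I_((T n).*2.+1) -> nat) -> bool -> S;
  run_refl : forall (n : nat) (f : 'I_((T n).*2.+1) -> nat) (b : bool),
     @run n (fun k => f (rev_ord k)) b = @run n f (~~ b) }.
Arguments run {S T} a n _ _.

Definition valid_ids (c n : nat) (id : 'I_n -> nat) : Prop :=
  injective id /\ forall v, id v < n ^ c.
Arguments valid_ids : clear implicits.

Definition solves (S : Type) (Sol : forall n, ('I_n -> bool -> S) -> Prop)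
  (c : nat) (T : nat -> nat) (A : Alg S T) : Prop :=
  forall n, 3 <= n -> forall id : 'I_n -> nat, valid_ids c n id ->
    Sol n (fun v => run A n (view (T n) id v)).

Definition solvable (S : Type) (Sol : forall n, ('I_n -> bool -> S) -> Prop)
  (c : nat) (T : nat -> nat) : Prop :=
  exists A : Alg S T, solves Sol c A.
Arguments solvable {S} Sol c T.

Definition bigO (f g : nat -> nat) : Prop :=
  exists C N, forall n, N <= n -> f n <= C * g n.

Fixpoint logstar_rec (fuel n : nat) : nat :=
  match fuel with
  | 0 => 0
  | fuel'.+1 => if n <= 1 then 0 else (logstar_rec fuel' (trunc_log 2 n)).+1
  end.
Definition logstar (n : nat) : nat := logstar_rec n n.

Definition same_complexity (S1 S2 : Type)
  (Sol1 : forall n, ('I_n -> bool -> S1) -> Prop)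
  (Sol2 : forall n, ('I_n -> bool -> S2) -> Prop) (c : nat) : Prop :=
  forall T : nat -> nat,
    (exists T1, bigO T1 T /\ solvable Sol1 c T1) <->
    (exists T2, bigO T2 T /\ solvable Sol2 c T2).

(* Main.v *)
From Stdlib Require Import ZArith Lia FunctionalExtensionality Classical ClassicalEpsilon.
Require Import Defs.
From mathcomp Require Import all_boot zify.

Set Implicit Arguments. Unset Strict Implicit. Unset Printing Implicit Defensive.

(** Let E be the relation "through a node, then across an edge" on half-edge labels.
    Run an algorithm whose radius T is small compared with n, and let C be the set of
    labels it produces.  Two disjoint windows of identifiers can be placed at any
    distance (at least 2T+1, small enough to fit) on one cycle, so the labels of C are
    joined by E-walks of two consecutive lengths, hence of all large lengths K, K+1, ...
    The problem P' asks for labels in C on long cycles, and for any solution of P on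
    short ones.  It is O(1)-mendable: around a hole one relabels either the whole short
    labelled runs or a window whose two outer labels are kept and joined by a walk.

    For the complexity there are three cases.  If some x may be used on every
    half-edge, P' is solved in 0 rounds.  Otherwise every algorithm for P needs at least
    one round on large n, so O(1) rounds are free.  If some such C has a loop a -> a of E,
    through a node labelled (a, b), identifiers are compared in radius k: away from the
    local maxima each node points to the side of the larger identifier, long stretches
    that point the same way use (a, b), and the remaining bounded intervals are filled
    by walks.  If no C has a loop, the left labels along increasing identifiers are a
    proper colouring, so Linial's argument gives an Omega(log* n) lower bound for P
    itself, while reducing the identifiers to O(1) colours and filling between
    local maxima of the colours solves P' in O(log* n) rounds. *)

(** * Positions on the cycle *)

Lemma at_subproof n (v : 'I_n) (z : Z) : Z.to_nat ((Z.of_nat v + z) mod Z.of_nat n) < n.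
Proof.
have := ltn_ord v => h.
have := Z.mod_pos_bound (Z.of_nat v + z) (Z.of_nat n). lia.
Qed.

(** Offsets are signed, unlike those of [cyc], so that reflecting the cycle is negation and no
    truncated subtraction arises. *)
Definition at_ n (v : 'I_n) (z : Z) : 'I_n := Ordinal (at_subproof v z).

Lemma at_eq n (v w : 'I_n) (y z k : Z) :
  (Z.of_nat v + y = Z.of_nat w + z + k * Z.of_nat n)%Z -> at_ v y = at_ w z.
Proof. by move=> e; apply: val_inj; rewrite /= e Z_mod_plus_full. Qed.

Lemma at_val n (v : 'I_n) z :
  exists k, (Z.of_nat (at_ v z) = Z.of_nat v + z + k * Z.of_nat n)%Z.
Proof.
have hv := ltn_ord v.
exists (- ((Z.of_nat v + z) / Z.of_nat n))%Z => /=.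
have := Z.mod_pos_bound (Z.of_nat v + z) (Z.of_nat n).
have := Z_div_mod_eq_full (Z.of_nat v + z) (Z.of_nat n).
set q := (_ / _)%Z; set m := (_ mod _)%Z; nia.
Qed.

Lemma at0 n (v : 'I_n) : at_ v 0 = v.
Proof.
apply: val_inj; rewrite /= Z.add_0_r Z.mod_small ?Nat2Z.id //.
have := ltn_ord v; lia.
Qed.

Lemma at_at n (v : 'I_n) y z : at_ (at_ v y) z = at_ v (y + z).
Proof. have [k e] := at_val v y; apply: (@at_eq _ _ _ _ _ k); lia. Qed.

Lemma at_addn n (v : 'I_n) z k : at_ v (z + k * Z.of_nat n) = at_ v z.
Proof. apply: (@at_eq _ _ _ _ _ k); lia. Qed.

Lemma at_inj n (v : 'I_n) y z :
  (Z.abs (y - z) < Z.of_nat n)%Z -> at_ v y = at_ v z -> y = z.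
Proof.
move=> lt e; have [k ek] := at_val v y; have [l el] := at_val v z.
rewrite e el in ek; have yz : (y - z = (l - k) * Z.of_nat n)%Z by lia.
have [h|[h|h]] : (l - k <= -1 \/ l - k = 0 \/ l - k >= 1)%Z by lia.
- nia.
- by rewrite h in yz; lia.
- nia.
Qed.

Lemma at_surj n (v u : 'I_n) (lo : Z) :
  exists2 z, (lo <= z < lo + Z.of_nat n)%Z & u = at_ v z.
Proof.
have hv := ltn_ord v.
have := Z.mod_pos_bound (Z.of_nat u - Z.of_nat v - lo) (Z.of_nat n).
have := Z_div_mod_eq_full (Z.of_nat u - Z.of_nat v - lo) (Z.of_nat n).
set q := (_ / _)%Z; set m := (_ mod _)%Z => e b.
exists (lo + m)%Z; first lia.
rewrite -[LHS]at0; apply: (@at_eq _ _ _ _ _ q); lia.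
Qed.

Lemma cycE n (v : 'I_n) k r : cyc v k r = at_ v (Z.of_nat k - Z.of_nat r).
Proof.
have hv := ltn_ord v.
apply: val_inj => /=.
have -> : (Z.of_nat v + (Z.of_nat k - Z.of_nat r) =
  Z.of_nat (v + k + n * r - r) + (- Z.of_nat r) * Z.of_nat n)%Z by nia.
rewrite Z_mod_plus_full; have := leq_ltn_trans (leq0n v) hv.
set x := (v + _ + _ - _) => n0.
rewrite -(@Z.mod_unique (Z.of_nat x) (Z.of_nat n) (Z.of_nat (x %/ n)) (Z.of_nat (x %% n))).
- by rewrite Nat2Z.id.
- by left; have := ltn_pmod x n0; lia.
- by rewrite {1}(divn_eq x n); lia.
Qed.

Lemma cyc1E n (v : 'I_n) : cyc v 1 0 = at_ v 1.
Proof. by rewrite cycE. Qed.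

Lemma cdist_at n (v : 'I_n) z : (cdist (at_ v z) v <= Z.to_nat (Z.abs z)).
Proof.
have hv := ltn_ord v; have hu := ltn_ord (at_ v z).
have [k e] := at_val v z; rewrite /cdist.
set u := nat_of_ord (at_ v z) in e hu *.
have [z0|z0] := Z_le_gt_dec 0 z.
  apply: leq_trans (geq_minl _ _) _.
  have -> : (u + n - v) %% n = Z.to_nat z %% n.
    have k1 : (k <= 0)%Z by nia.
    rewrite -(modnMDl (Z.to_nat (- k)) (u + n - v)) -(modnMDl 1 (Z.to_nat z)).
    congr (_ %% _); nia.
  apply: leq_trans (leq_mod _ _) _; lia.
apply: leq_trans (geq_minr _ _) _.
have -> : (v + n - u) %% n = Z.to_nat (- z) %% n.
  have k1 : (0 <= k)%Z by nia.
  rewrite -(modnMDl (Z.to_nat k) (v + n - u)) -(modnMDl 1 (Z.to_nat (- z))).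
  congr (_ %% _); nia.
apply: leq_trans (leq_mod _ _) _; lia.
Qed.

Lemma cdist_lt n (u v : 'I_n) : cdist u v < n.
Proof. by apply: leq_ltn_trans (geq_minl _ _) _; rewrite ltn_mod (ord_pos u). Qed.

(** * Labels realised by an algorithm *)

(** Here [x] and [y] are left labels of nodes [m] apart; each step picks the right label [z] of the
    current node and the left label [w] of the next. *)
Fixpoint walk (P : NELCL) (C : pred (gam P)) m (x y : gam P) : Prop :=
  if m is m'.+1 then
    exists z w, [/\ C z, C w, cnode P x z, cedge P z w & walk C m' w y]
  else x = y.

Lemma walk_cat P (C : pred (gam P)) m m' x y z :
  walk C m x y -> walk C m' y z -> walk C (m + m') x z.
Proof.
elim: m x => [|m IH] x /= => [-> //|[a [b [Ca Cb na eb wb]]] w2].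
by exists a, b; split=> //; apply: IH w2.
Qed.

Lemma walk_iter P (C : pred (gam P)) m x i : walk C m x x -> walk C (i * m) x x.
Proof. by move=> w; elim: i => // i IH; rewrite mulSn; apply: walk_cat w IH. Qed.

(** Coin problem for m and m + 1: write k = q m + r and use r closed walks of length m + 1 and q - r
    of length m. The bound m^2 <= k gives r < m <= q. *)
Lemma walk_flexible P (C : pred (gam P)) m x k :
  walk C m x x -> walk C m.+1 x x -> m ^ 2 <= k -> walk C k x x.
Proof.
have [->|m0] := posnP m.
  by move=> _ w1 _; rewrite -[k]muln1; apply: walk_iter.
move=> w w1; move=> le; have lt := ltn_pmod k m0.
have le2 : m <= k %/ m by rewrite leq_divRL.
have -> : k = (k %/ m - k %% m) * m + (k %% m) * m.+1.
  rewrite {1}(divn_eq k m) mulnBl mulnS addnCA subnK; first by rewrite addnC.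
  by rewrite leq_mul2r (leq_trans (ltnW lt) le2) orbT.
by apply: walk_cat; apply: walk_iter.
Qed.

(** Only identifiers below n are used; they are valid for every exponent c > 0. *)
Definition window n k (u : seq nat) := [&& uniq u, size u == k & all (fun x => x < n) u].

Lemma windowP n k u : reflect [/\ uniq u, size u = k & {in u, forall x, x < n}] (window n k u).
Proof.
apply: (iffP and3P) => [[-> /eqP -> /allP h]|[-> -> h]] //.
by split=> //; apply/allP.
Qed.

Lemma fresh_window n k (l : seq nat) : size l + k <= n ->
  exists2 w, window n k w & {in w, forall x, x \notin l}.
Proof.
move=> le; set f := [seq x <- iota 0 n | x \notin l].
have sf : n - size l <= size f.
  have : size [seq x <- iota 0 n | x \in l] <= size l.
    apply: uniq_leq_size; first by rewrite filter_uniq ?iota_uniq.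
    by move=> x; rewrite mem_filter => /andP[].
  rewrite /f !size_filter -[X in X - _](size_iota 0).
  by rewrite -(count_predC (mem l) (iota 0 n)) leq_subLR leq_add2r.
have inf x : x \in take k f -> x < n /\ x \notin l.
  by move/mem_take; rewrite mem_filter mem_iota => /andP[-> ].
exists (take k f); last by move=> x /inf[].
apply/windowP; split; last by move=> x /inf[].
  by rewrite take_uniq // filter_uniq // iota_uniq.
by rewrite size_take_min; apply/minn_idPl; lia.
Qed.

(* [L u] is the label that the centre of the window [u] of identifiers puts on
   its left half-edge; by equivariance [L (rev u)] is the one on the right. *)
Definition window_rule (P : NELCL) n T (L : seq nat -> gam P) : Prop :=
  (forall u, window n T.*2.+1 u -> cnode P (L u) (L (rev u))) /\
  (forall w, window n T.*2.+2 w ->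
     cedge P (L (rev (take T.*2.+1 w))) (L (behead w))).
Arguments window_rule : clear implicits.

(** Windows are encoded as tuples of ordinals so that membership is decided by a finite search. *)
Definition window_labels (P : NELCL) n T (L : seq nat -> gam P) : pred (gam P) :=
  fun x => [exists u : T.*2.+1.-tuple 'I_n, uniq u && (L (map val u) == x)].
Arguments window_labels : clear implicits.

Lemma window_labelsP P n T L x :
  reflect (exists2 u, window n T.*2.+1 u & L u = x) (window_labels P n T L x).
Proof.
apply: (iffP existsP) => [[u /andP[uu /eqP <-]]|[u /windowP[uu su lu] <-]].
  exists (map val u) => //; apply/windowP; split.
  - by rewrite map_inj_uniq //; apply: val_inj.
  - by rewrite size_map size_tuple.
  - by move=> y /mapP[z _ ->]; apply: ltn_ord.
have [v ev] : exists v : seq 'I_n, map val v = u.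
  exists (pmap insub u); rewrite pmap_filter; last exact: insubK.
  by apply/all_filterP/allP => y /lu ly; rewrite insubT.
have sv : size v == T.*2.+1 by rewrite -su -ev size_map.
exists (Tuple sv) => /=; rewrite ev eqxx andbT.
by rewrite -(map_inj_uniq val_inj) ev.
Qed.

(** This describes holes of m nodes: [x] is the right label before the hole, [u] the left label of
    its first node and [y] the left label after the hole. *)
Definition good (P : NELCL) (C : pred (gam P)) (K : nat) : Prop :=
  (exists x, C x) /\
  forall x y m, C x -> C y -> K <= m ->
    exists u, [/\ C u, cedge P x u & walk C m u y].
Arguments good : clear implicits.

Section WindowLabels.
Variables (P : NELCL) (n T : nat) (L : seq nat -> gam P).
Hypothesis LP : window_rule P n T L.
Local Notation k := (T.*2.+1).
Let C := window_labels P n T L.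

Lemma window_rev u j : window n j u -> window n j (rev u).
Proof.
move/windowP=> [uu su lu]; apply/windowP.
by split; rewrite ?rev_uniq ?size_rev // => x; rewrite mem_rev => /lu.
Qed.

Lemma window_take s j i : window n j s -> i <= j -> window n i (take i s).
Proof.
move/windowP=> [us ss ls] le; apply/windowP; split.
- exact: take_uniq.
- by rewrite size_take_min ss; apply/minn_idPl.
- by move=> x /mem_take /ls.
Qed.

Lemma window_behead s j : window n j.+1 s -> window n j (behead s).
Proof.
move/windowP; case: s => [[]//|x s [/andP[_ us] [ss] ls]]; apply/windowP; split=> //.
by move=> y ys; apply: ls; rewrite inE ys orbT.
Qed.

Lemma inC u : window n k u -> C (L u).
Proof. by move=> w; apply/window_labelsP; exists u. Qed.

(** Sliding the window by one place along [s] is one step: the right label in between is that of the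
    reversed window. *)
Lemma window_walk d s : window n (k + d) s -> walk C d (L (take k s)) (L (drop d s)).
Proof.
elim: d s => [|d IH] s ws.
  rewrite /= drop0 take_oversize //.
  by move/windowP: ws => [_ -> _]; rewrite addn0.
have wt : window n k.+1 (take k.+1 s) by apply: window_take ws _; lia.
have wb : window n (k + d) (behead s) by apply: window_behead; rewrite -addnS.
exists (L (rev (take k s))), (L (take k (behead s))).
have wk : window n k (take k s) by apply: window_take ws _; lia.
split.
- exact/inC/window_rev.
- by apply: inC; apply: window_take wb _; lia.
- exact: LP.1.
- have := LP.2 _ wt; rewrite take_takel //.
  by case: (s) (windowP _ _ _ ws) => [[]//|a s' _].
- by case: (s) (IH _ wb).
Qed.

Lemma disjoint_walk u g w : window n k u -> window n k w -> uniq (u ++ g ++ w) ->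
  {in g, forall x, x < n} -> walk C (k + size g) (L u) (L w).
Proof.
move=> /windowP[uu su lu] /windowP[uw sw lw] ug lg.
have ws : window n (k + (k + size g)) (u ++ g ++ w).
  apply/windowP; split=> //; first by rewrite !size_cat su sw (addnC (size g)).
  by move=> x; rewrite !mem_cat => /or3P[/lu|/lg|/lw].
have := window_walk ws.
rewrite take_size_cat // drop_cat su ltnNge leq_addr /= addKn drop_size_cat //.
Qed.

Lemma uniq_disjoint (u w : seq nat) : uniq u -> uniq w -> {in w, forall x, x \notin u} ->
  uniq (u ++ w).
Proof.
move=> uu uw d; rewrite cat_uniq uu uw andbT /=; apply/hasPn => x xw; exact: d.
Qed.

(** After the first edge, at a window [b], go in k steps to a window [w] disjoint from [b] and [v],
    stay there on closed walks, and end with k steps to [v]. Going from [w] to a disjoint [w'] and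
    back takes 2k steps, or 2k + 1 with one identifier in between, so every length from (2k)^2 on is
    available at [w]. Three disjoint windows must fit among the n identifiers. *)
Lemma window_labels_good : 3 * k <= n -> good P C ((2 * k) ^ 2 + 2 * k).
Proof.
move=> kn; split.
  have [|w ww _] := @fresh_window n k [::]; first by rewrite /=; lia.
  by exists (L w); apply: inC.
move=> x y m /window_labelsP[u wu <-] /window_labelsP[v wv <-] mK.
have [q kq mq] : exists2 q, (2 * k) ^ 2 <= q & m = k + (q + k).
  by exists (m - 2 * k); move: mK; move: ((2 * k) ^ 2) => q; lia.
have [|s ws _] := @fresh_window n k.+1 [::]; first by rewrite /=; lia.
have su : size u = k by case/windowP: wu.
have sv : size v = k by case/windowP: wv.
(* [L u] is read as the right label of [rev u], so that an edge leaves it. *)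
have [|a wa da] := @fresh_window n 1 u; first by rewrite su; lia.
set u' := rev u.
have wu' : window n k u' by apply: window_rev.
set w0 := rcons u' (head 0 a).
have ha : head 0 a \in a by case/windowP: wa => _; case: (a) => // b l; rewrite inE eqxx.
have ww0 : window n k.+1 w0.
  case/windowP: wu' => uu' su' lu'; case/windowP: wa => _ _ la; apply/windowP; split.
  - by rewrite rcons_uniq uu' mem_rev da.
  - by rewrite size_rcons su'.
  - by move=> z; rewrite mem_rcons inE => /orP[/eqP ->|/lu' //]; apply: la.
have e0 := LP.2 _ ww0.
have tw0 : take k w0 = u'.
  by rewrite /w0 -cats1 take_size_cat // size_rev su.
rewrite tw0 revK in e0.
have wb := window_behead ww0.
exists (L (behead w0)); split=> //; first exact: inC.
move: (behead w0) wb => b wb {e0 tw0 ww0 w0}.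
have sb : size b = k by case/windowP: wb.
have [|w ww dw] := @fresh_window n k (b ++ v); first by rewrite size_cat sb sv; lia.
have sw : size w = k by case/windowP: ww.
have [|w' ww' dw'] := @fresh_window n k w; first by rewrite sw; lia.
have sw' : size w' = k by case/windowP: ww'.
have [|e we de] := @fresh_window n 1 (w ++ w'); first by rewrite size_cat sw sw'; lia.
have [ub uv uw uw'] : [/\ uniq b, uniq v, uniq w & uniq w'].
  by case/windowP: wb; case/windowP: wv; case/windowP: ww; case/windowP: ww'.
have [ue se le] := windowP _ _ _ we.
have bw : walk C k (L b) (L w).
  rewrite -[X in walk C X]addn0; apply: (@disjoint_walk _ [::]) => //=.
  by apply: uniq_disjoint => // z /dw; rewrite mem_cat negb_or => /andP[].
have wv' : walk C k (L w) (L v).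
  rewrite -[X in walk C X]addn0; apply: (@disjoint_walk _ [::]) => //=.
  by rewrite uniq_catC; apply: uniq_disjoint => // z /dw; rewrite mem_cat negb_or => /andP[].
have c1 : walk C k (L w) (L w').
  rewrite -[X in walk C X]addn0; apply: (@disjoint_walk _ [::]) => //=.
  exact: uniq_disjoint.
have c2 : walk C k (L w') (L w).
  rewrite -[X in walk C X]addn0; apply: (@disjoint_walk _ [::]) => //=.
  by rewrite uniq_catC; apply: uniq_disjoint.
have c3 : walk C k.+1 (L w) (L w').
  rewrite -addn1 -se; apply: disjoint_walk => //.
  by rewrite uniq_catCA uniq_catC; apply: uniq_disjoint => //; apply: uniq_disjoint.
rewrite mq; apply: walk_cat bw _; apply: walk_cat wv'.
apply: (@walk_flexible _ _ (2 * k)) => //.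
  by rewrite mul2n -addnn; apply: walk_cat c1 c2.
by rewrite mul2n -addnn -addSn; apply: walk_cat c3 c2.
Qed.

End WindowLabels.

(** * Lower bounds *)

Definition alg_label (S : Type) T (A : Alg S T) n (u : seq nat) : S :=
  run A n (fun k => nth 0 u k) false.

Lemma alg_label_rev (S : Type) T (A : Alg S T) n (u : seq nat) :
  size u = (T n).*2.+1 -> alg_label A n (rev u) = run A n (fun k => nth 0 u k) true.
Proof.
move=> su; rewrite /alg_label -[RHS](run_refl A (n := n) (fun k => nth 0 u k) false).
congr (run A n _ false); apply: functional_extensionality => i.
by rewrite nth_rev su ?ltn_ord.
Qed.

Lemma window_ids c n j w : 0 < c -> j <= n -> window n j w ->
  exists2 id, valid_ids c n id & forall v : 'I_n, v < j -> id v = nth 0 w v.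
Proof.
move=> c0 jn /windowP[uw sw lw].
have [|r /windowP[ur sr lr] dr] := @fresh_window n (n - j) w; first by rewrite sw subnKC.
exists (fun v => nth 0 (w ++ r) v); last by move=> v vj; rewrite nth_cat sw vj.
have sz : size (w ++ r) = n by rewrite size_cat sw sr subnKC.
split=> [v v' /eqP|v].
  by rewrite nth_uniq ?sz ?ltn_ord ?uniq_disjoint // => /eqP /val_inj.
apply: (@leq_trans n).
  have : nth 0 (w ++ r) v \in w ++ r by rewrite mem_nth // sz.
  by rewrite mem_cat => /orP[/lw|/lr].
by rewrite -[X in X <= _]expn1 leq_pexp2l // (leq_ltn_trans _ (ltn_ord v)).
Qed.

(** With the window placed from node 0 on, the nodes t and t + 1 see the nodes 0 to 2t and 1 to 2t +
    1, so neither view wraps around. *)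
Lemma alg_window_rule P c T (A : Alg (gam P) T) n :
  0 < c -> solves (NEsol P) c A -> 3 <= n -> (T n).*2.+2 <= n ->
  window_rule P n (T n) (alg_label A n).
Proof.
move=> c0 sA n3 Tn; set t := T n.
have tn : t < n by lia.
have vw j w (wj : window n j w) (le : t.*2.+1 <= j) (jn : j <= n) id :
    (forall v : 'I_n, v < j -> id v = nth 0 w v) ->
    view t id (Ordinal tn) = (fun k : 'I_(t.*2.+1) => nth 0 (take t.*2.+1 w) k).
  move=> e; apply: functional_extensionality => k; rewrite /view nth_take ?ltn_ord //.
  have ek : nat_of_ord (cyc (Ordinal tn) k t) = k.
    have lk := ltn_ord k.
    have /= -> : t + k + n * t - t = t * n + k by lia.
    by rewrite modnMDl modn_small //; lia.
  by rewrite e ek // (leq_trans (ltn_ord k)).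
split=> [u wu|w ww].
  have [|id vid e] := window_ids c0 _ wu; first by lia.
  have := sA n n3 id vid (Ordinal tn); rewrite (vw _ _ wu) //; last by lia.
  have su : size u = t.*2.+1 by case/windowP: wu.
  by rewrite take_oversize ?su // => /andP[h _]; rewrite alg_label_rev.
have [|id vid e] := window_ids c0 _ ww; first by lia.
have := sA n n3 id vid (Ordinal tn); rewrite (vw _ _ ww) // => /andP[_].
have sw : size w = t.*2.+2 by case/windowP: ww.
rewrite alg_label_rev ?size_take ?sw ?ltnSn //.
suff -> : view t id (cyc (Ordinal tn) 1 0) = (fun k : 'I_(t.*2.+1) => nth 0 (behead w) k) by [].
apply: functional_extensionality => k; rewrite /view nth_behead.
have ek : nat_of_ord (cyc (cyc (Ordinal tn) 1 0) k t) = k.+1.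
  have lk := ltn_ord k.
  rewrite /= muln0 addn0 subn0 (@modn_small (t + 1)); last by lia.
  have -> : t + 1 + k + n * t - t = t * n + k.+1 by lia.
  by rewrite modnMDl modn_small //; lia.
by rewrite e ek //; have := ltn_ord k; lia.
Qed.

(* Each step trades one identifier of the window for an exponentially larger set
   of colours: a (k-1)-tuple is coloured by the set of colours of its extensions. *)
Lemma linial n k (X : finType) (g : seq nat -> X) :
  (forall w, size w = k.+2 -> sorted ltn w -> {in w, forall x, x < n} ->
     g (take k.+1 w) <> g (behead w)) ->
  n <= iter k (expn 2) #|X|.
Proof.
elim: k X g => [|k IH] X g H.
  rewrite /= -[n in X in X <= _]card_ord.
  have inj (i j : 'I_n) : i < j -> g [:: val i] <> g [:: val j].
    move=> lt; apply: (H [:: val i; val j]) => [//||x]; first by rewrite /= lt.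
    by rewrite !inE => /orP[]/eqP->; apply: ltn_ord.
  apply: (@leq_card _ _ (fun i : 'I_n => g [:: val i])) => i j e.
  by apply: val_inj; case: (ltngtP i j) => // /inj; rewrite e.
rewrite iterSr -cardsT -card_powerset powersetT cardsT.
pose g' u := [set x | has (fun y => (last 0 u < y) && (g (rcons u y) == x)) (iota 0 n)].
apply: (IH _ g') => w; case/lastP: w => // s y; rewrite size_rcons => -[ss] ow lw.
rewrite -{1}cats1 take_size_cat //; case: s ss ow lw => // x s [ss] ow lw e.
have : g (rcons (x :: s) y) \in g' (x :: s).
  rewrite inE; apply/hasP; exists y.
    by rewrite mem_iota; apply: lw; rewrite mem_rcons inE eqxx.
  by move: ow; rewrite eqxx andbT /= rcons_path => /andP[].
rewrite e inE => /hasP[z]; rewrite mem_iota /= add0n last_rcons => zn /andP[yz /eqP eg].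
apply: (H (rcons (rcons (x :: s) y) z)).
- by rewrite !size_rcons /= ss.
- by move: ow => /=; rewrite !rcons_path last_rcons => ->.
- by move=> t; rewrite mem_rcons inE => /orP[/eqP->|/lw].
- rewrite -cats1 take_size_cat ?size_rcons /= ?ss //.
  by rewrite cats1 eg.
Qed.

Lemma logstar_rec_le f n : logstar_rec f n <= n.
Proof.
elim: f n => //= f IH n; case: (leqP n 1) => // n1.
apply: leq_ltn_trans (IH _) _.
by apply: leq_trans (ltn_expl _ (ltnSn 1)) _; apply: trunc_logP; rewrite // ltnW.
Qed.

(** Each logarithm removes one level of the tower; at its foot the trivial bound [logstar_rec_le]
    suffices. *)
Lemma logstar_rec_tower f n k m : n <= iter k (expn 2) m -> logstar_rec f n <= k + m.
Proof.
elim: k f n => [|k IH] [|f] n //=.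
  by move=> le; apply: leq_trans (logstar_rec_le f.+1 n) le.
move=> le; case: (leqP n 1) => // n1; rewrite addSn ltnS; apply: IH.
by rewrite -[X in _ <= X](@trunc_expnK 2) //; apply: leq_trunc_log.
Qed.

Lemma logstar_log n : logstar n <= (trunc_log 2 n).+1.
Proof. by rewrite /logstar; case: n => //= n; case: (leqP n.+1 1) => // _; apply: logstar_rec_le. Qed.

(** The number 2^(2i) is at least (i + 1)^2 while its [logstar] is at most 2i + 1. This supplies a
    cycle long enough for the windows of a fast algorithm. *)
Lemma logstar_sublinear a N : exists n, [/\ N <= n, 3 <= n & a * logstar n + 4 <= n].
Proof.
pose i := 2 * a + N + 4.
have lo : i.+1 ^ 2 <= 2 ^ (2 * i).
  by rewrite mulnC expnM leq_exp2r // ltn_expl.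
have big : i.+1 ^ 2 = i * i + 2 * i + 1 by rewrite -mulnn; lia.
rewrite big in lo.
exists (2 ^ (2 * i)); split; [lia | lia|].
have := logstar_log (2 ^ (2 * i)); rewrite trunc_expnK // => h.
apply: leq_trans lo; rewrite /i in h *; nia.
Qed.

(** If two consecutive windows of an increasing sequence had the same left label a, the right label
    b of the first would give the loop: (a, b) at a node and (b, a) on an edge. So [L] is a
    colouring to which [linial] applies. *)
Lemma loopless_logstar P n T (L : seq nat -> gam P) :
  window_rule P n T L -> 
  (forall a b, window_labels P n T L a -> window_labels P n T L b ->
     ~~ (cnode P a b && cedge P b a)) ->
  logstar n <= T.*2 + #|gam P|.
Proof.
move=> [LN LE] nl; apply: logstar_rec_tower; apply: (@linial n _ _ L) => w sw ow lw e.
have ww : window n T.*2.+2 w.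
  by apply/windowP; split=> //; apply: sorted_uniq ow => //; [apply: ltn_trans | apply: ltnn].
have wt : window n T.*2.+1 (take T.*2.+1 w) by apply: window_take ww _.
have := nl _ _ (inC L wt) (inC L (window_rev wt)); rewrite (LN _ wt) {1}e.
by rewrite LE.
Qed.

(** By pigeonhole two identifiers get the same label, and a window of one identifier equals its
    reverse, so this label is on both halves of a node and of an edge. *)
Lemma zero_round_constant P n (L : seq nat -> gam P) :
  window_rule P n 0 L -> #|gam P| < n -> exists x, cnode P x x && cedge P x x.
Proof.
move=> [LN LE] lt; apply: NNPP => no.
suff : n <= #|gam P| by rewrite leqNgt lt.
apply: (@linial n 0 _ L) => w sw ow lw e; apply: no.
have ww : window n 2 w.
  by apply/windowP; split=> //; apply: sorted_uniq ow => //; [apply: ltn_trans | apply: ltnn].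
have wt : window n 1 (take 1 w) by apply: window_take ww _.
have er : rev (take 1 w) = take 1 w by case: (w) => [|a []].
have h1 : cedge P (L (rev (take 1 w))) (L (behead w)) by exact: LE ww.
have h2 := LN _ wt.
rewrite er in h1 h2; rewrite -e in h1; exists (L (take 1 w)).
by apply/andP; split.
Qed.

(** * Local rules and the filling of holes *)

(* The identifiers seen from a node, at signed offsets from it. *)
Notation zseq := (Z -> nat).
Definition shift (i : Z) (s : zseq) : zseq := fun j => s (i + j)%Z.
Definition mirror (s : zseq) : zseq := fun j => s (- j)%Z.

Definition local X (t : nat) (F : zseq -> X) : Prop :=
  forall s s', (forall j, (Z.abs j <= Z.of_nat t)%Z -> s j = s' j) -> F s = F s'.
Definition equivariant S (F : zseq -> bool -> S) : Prop :=
  forall s b, F (mirror s) b = F s (~~ b).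

Lemma shift_shift i j s : shift i (shift j s) = shift (j + i) s.
Proof. by apply: functional_extensionality => k; rewrite /shift; congr s; lia. Qed.

Lemma shift0 s : shift 0 s = s.
Proof. by apply: functional_extensionality => k; rewrite /shift. Qed.

Lemma shift_mirror i s : shift i (mirror s) = mirror (shift (- i) s).
Proof. by apply: functional_extensionality => k; rewrite /shift /mirror; congr s; lia. Qed.

Lemma mirrorK s : mirror (mirror s) = s.
Proof. by apply: functional_extensionality => k; rewrite /mirror; congr s; lia. Qed.

Lemma localW X t t' (F : zseq -> X) : t <= t' -> local t F -> local t' F.
Proof. by move=> le h s s' e; apply: h => j hj; apply: e; lia. Qed.

(** The sequence [ext f] has arbitrary values beyond offset t, on which a rule of radius t does not
    depend. *)
Lemma run_of_local S t (F : zseq -> bool -> S) : local t F -> equivariant F ->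
  exists run : ('I_(t.*2.+1) -> nat) -> bool -> S,
    (forall f b, run (fun k => f (rev_ord k)) b = run f (~~ b)) /\
    (forall n (id : 'I_n -> nat) v b, run (view t id v) b = F (fun i => id (at_ v i)) b).
Proof.
move=> lF eF.
pose ext (f : 'I_(t.*2.+1) -> nat) : zseq := fun j => f (inord (Z.to_nat (j + Z.of_nat t))).
exists (fun f => F (ext f)); split=> [f b|n id v b].
  rewrite -eF; congr (_ b).
  apply: lF => j hj; rewrite /ext /mirror; congr f; apply: val_inj.
  by rewrite /= !inordK; lia.
congr (_ b); apply: lF => j hj; rewrite /ext /view cycE inordK; last lia.
by congr (id (at_ v _)); lia.
Qed.

Section Fill.
Variables (P : NELCL) (C : pred (gam P)) (K : nat).
Hypotheses (symP : symmetricNE P) (gC : good P C K).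

(** Nodes 1 to m form the hole; of the end nodes 0 and m + 1 only the half-edge facing the hole is
    prescribed. *)
Definition filler (f : nat -> bool -> gam P) (x y : gam P) (m : nat) : Prop :=
  [/\ f 0 true = x, f m.+1 false = y,
      forall i, i <= m -> cedge P (f i true) (f i.+1 false),
      forall i, 0 < i <= m -> cnode P (f i false) (f i true) &
      forall i b, 0 < i <= m -> C (f i b)].

Lemma filler_exists x y m : C x -> C y -> K <= m -> exists f, filler f x y m.
Proof.
move=> Cx Cy Km; have [u [Cu exu w]] := gC.2 x y m Cx Cy Km.
suff [g [g0 gm gs]] : exists g : nat -> bool -> gam P,
  [/\ g 0 false = u, g m false = y & forall i, i < m ->
      [/\ cnode P (g i false) (g i true), cedge P (g i true) (g i.+1 false) & forall b, C (g i b)]].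
  exists (fun i => if i is i'.+1 then g i' else fun _ => x); split=> //.
  - by case=> [|i] im; [rewrite g0 | have [] := gs i im].
  - by case=> // i /= im; have [] := gs i im.
  - by case=> // i b /= im; have [_ _] := gs i im.
elim: m u {exu Km} Cu w => [|m IH] u Cu /=.
  by move=> ->; exists (fun _ _ => y).
move=> [z [w [Cz Cw n_uz e_zw /(IH _ Cw) [g [g0 gm gs]]]]].
exists (fun i => if i is i'.+1 then g i' else fun b => if b then z else u); split=> //.
by case=> [|i] im; [split=> //= [|[]]; rewrite ?g0 | apply: gs].
Qed.

Lemma filler_rev f x y m : filler f x y m ->
  filler (fun i b => f (m.+1 - i) (~~ b)) y x m.
Proof.
case: symP => se [sn _]; case=> f0 fm fe fn fC; split=> /=.
- by rewrite subn0.
- by rewrite subnn.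
- move=> i im; rewrite se subSS subSn //; apply: fe; lia.
- by move=> i im; rewrite sn; apply: fn; lia.
- by move=> i b im; apply: fC; lia.
Qed.

(** The choice depends on [x], [y] and [m] alone, so all nodes of a hole agree on it without
    communicating. *)
Definition the_filler x y m : nat -> bool -> gam P :=
  epsilon (inhabits (fun _ _ => x)) (fun f => filler f x y m).

Lemma the_fillerP x y m : C x -> C y -> K <= m -> filler (the_filler x y m) x y m.
Proof. 
move=> Cx Cy Km.
exact: (epsilon_spec _ (fun f => filler f x y m) (filler_exists Cx Cy Km)). Qed.

(** The partial rule [G] labels some nodes at once, the anchors; [B] bounds the distance to the next
    anchor, [d] is a dummy label, and [V] selects the admissible sequences. *)
Variables (G : zseq -> option (bool -> gam P)) (t B : nat) (d : gam P) (V : zseq -> Prop).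

Definition flip (l : bool -> gam P) : bool -> gam P := fun b => l (~~ b).

(** The direction [e] is 1 or -1, and the value [B] means that the search found no anchor. *)
Definition gap (e : Z) (s : zseq) : nat :=
  find (fun j => isSome (G (shift (e * Z.of_nat j.+1) s))) (iota 0 B).

(* The two ends of a hole are compared by identifier, so that both sides agree
   on the direction in which the chosen filler is read. *)
Definition fill (s : zseq) (b : bool) : gam P :=
  if G s is Some l then l b else
  let a := gap (-1) s in let c := gap 1 s in
  let p := (- Z.of_nat a.+1)%Z in let q := Z.of_nat c.+1 in
  match G (shift p s), G (shift q s) with
  | Some l, Some l' =>
      if s p < s q then the_filler (l true) (l' false) (a + c).+1 a.+1 b
      else if s q < s p then the_filler (l' false) (l true) (a + c).+1 c.+1 (~~ b)
      else d
  | _, _ => d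
  end.

Hypothesis lG : local t G.
Hypothesis eG : forall s, G (mirror s) = omap flip (G s).

Lemma gap_mirror e s : gap e (mirror s) = gap (- e) s.
Proof.
apply: eq_find => j; rewrite shift_mirror eG -Z.mul_opp_l.
by case: (G _).
Qed.

Lemma fill_equivariant : equivariant fill.
Proof.
move=> s b; rewrite /fill !gap_mirror !shift_mirror !eG.
case: (G s) => //=.
set a := gap (-1) s; set c := gap 1 s.
case: (G (shift (Z.neg _) s)) => [l|]; case: (G (shift (Z.pos _) s)) => [l'|] //=.
by rewrite /mirror /flip /= !negbK (addnC c); case: ltngtP.
Qed.

Lemma gap_le e s : gap e s <= B.
Proof. by rewrite -[X in _ <= X](size_iota 0); apply: find_size. Qed.

Lemma gap_local e : (Z.abs e = 1)%Z -> local (t + B) (gap e).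
Proof.
move=> e1 s s' ess; apply: eq_in_find => j; rewrite mem_iota => jB; congr isSome.
apply: lG => i hi; rewrite /shift; apply: ess; nia.
Qed.

Lemma fill_local : local (t + B.+1) fill.
Proof.
move=> s s' e.
have es u : (Z.abs u <= Z.of_nat B.+1)%Z -> G (shift u s) = G (shift u s').
  by move=> hu; apply: lG => i hi; rewrite /shift; apply: e; lia.
have eg r : (Z.abs r = 1)%Z -> gap r s = gap r s'.
  by move=> r1; apply: gap_local => // j hj; apply: e; lia.
apply: functional_extensionality => b; rewrite /fill -!eg //.
rewrite -[s]shift0 -[s']shift0 -es ?shift0; last lia.
have := gap_le (-1) s; have := gap_le 1 s; set a := gap _ s; set c := gap _ s => aB cB.
case: (G s) => //; rewrite -!es; try lia.
by rewrite -!e; try lia.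
Qed.

Hypothesis shiftV : forall i s, V s -> V (shift i s).
Hypothesis distinctV : forall s i j, V s ->
  (0 < Z.abs (i - j) <= Z.of_nat B)%Z -> s i <> s j.
Hypothesis G_label : forall s l, V s -> G s = Some l ->
  [/\ C (l false), C (l true) & cnode P (l false) (l true)].
Hypothesis G_edge : forall s l l', V s -> G s = Some l -> G (shift 1 s) = Some l' ->
  cedge P (l true) (l' false).
Hypothesis G_dense : forall e s, (Z.abs e = 1)%Z -> V s ->
  exists2 j, j < B & G (shift (e * Z.of_nat j.+1) s) <> None.
Hypothesis G_sparse : forall s m, V s -> G s <> None -> G (shift (Z.of_nat m.+1) s) <> None ->
  (forall i, 0 < i <= m -> G (shift (Z.of_nat i) s) = None) -> 0 < m -> K <= m.

Lemma gapP e s : (Z.abs e = 1)%Z -> V s ->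
  [/\ gap e s < B, G (shift (e * Z.of_nat (gap e s).+1) s) <> None &
      forall i, i < gap e s -> G (shift (e * Z.of_nat i.+1) s) = None].
Proof.
move=> e1 Vs; have [j jB nj] := G_dense e1 Vs.
pose h j := isSome (G (shift (e * Z.of_nat j.+1) s)).
have hh : has h (iota 0 B).
  by apply/hasP; exists j; rewrite ?mem_iota //; move: nj; rewrite /h; case: (G _).
have lt : gap e s < B by move: (hh); rewrite has_find size_iota.
split=> // [|i ig].
  have := nth_find 0 hh; rewrite nth_iota // add0n -/(gap e s) /h.
  by case: (G _).
have := before_find 0 ig; rewrite nth_iota ?(ltn_trans ig) // add0n.
by case: (G _).
Qed.

Lemma gap_unique e s j : j < B -> G (shift (e * Z.of_nat j.+1) s) <> None ->
  (forall i, i < j -> G (shift (e * Z.of_nat i.+1) s) = None) -> gap e s = j.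
Proof.
move=> jB nj lo.
pose h j := isSome (G (shift (e * Z.of_nat j.+1) s)).
have hj : h j by move: nj; rewrite /h; case: (G _).
have hh : has h (iota 0 B) by apply/hasP; exists j; rewrite ?mem_iota.
have lt : gap e s < B by move: (hh); rewrite has_find size_iota.
case: (ltngtP (gap e s) j) => // [/lo|].
  by have := nth_find 0 hh; rewrite nth_iota // add0n -/(gap e s) /h; case: (G _).
by move/(before_find 0); rewrite nth_iota // add0n => hj'; rewrite /h hj' in hj.
Qed.

(** Every node of the hole after the anchor computes the same ends, the same length m and the same
    comparison of identifiers, so all of them read one common filler. *)
Lemma fill_block s l : V s -> G s = Some l -> exists m l' f,
  [/\ G (shift (Z.of_nat m.+1) s) = Some l', filler f (l true) (l' false) m,
      m = gap 1 s &
      forall i b, 0 < i <= m -> fill (shift (Z.of_nat i) s) b = f i b].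
Proof.
move=> Vs Gs; case: (@gapP 1 s erefl Vs); rewrite Z.mul_1_l.
set m := gap 1 s => gB Gq lo; have em : m = gap 1 s by []; clearbody m.
case Gm: (G _) Gq => [l'|] // _; exists m, l'.
have [Cl0 Cl1 nl] := G_label Vs Gs; have [Cm0 Cm1 nm] := G_label (shiftV _ Vs) Gm.
have [m0|m0] := posnP m.
  rewrite m0 in Gm em *; exists (fun i => if i is 0 then l else l').
  split=> //; last by case.
  split=> //; try by case.
  by case=> // _; apply: G_edge Vs Gs Gm.
have lo' i : 0 < i <= m -> G (shift (Z.of_nat i) s) = None.
  by case: i => // i /andP[_ im]; have := lo i im; rewrite Z.mul_1_l.
have Km : K <= m by apply: (G_sparse Vs) m0; rewrite ?Gs ?Gm.
pose f := if s 0%Z < s (Z.of_nat m.+1) then the_filler (l true) (l' false) m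
  else (fun i b => the_filler (l' false) (l true) m (m.+1 - i) (~~ b)).
exists f; split=> //.
  rewrite /f; case: ifP => _; first exact: the_fillerP.
  by apply: filler_rev; apply: the_fillerP.
move=> i b im; rewrite /fill lo' //.
have -> : gap (-1) (shift (Z.of_nat i) s) = i.-1.
  apply: gap_unique; first by lia.
  - rewrite shift_shift.
    have -> : (Z.of_nat i + -1 * Z.of_nat i.-1.+1)%Z = 0%Z by lia.
    by rewrite shift0 Gs.
  - move=> j ji; rewrite shift_shift.
    have -> : (Z.of_nat i + -1 * Z.of_nat j.+1)%Z = Z.of_nat (i - j.+1) by lia.
    by apply: lo'; lia.
have -> : gap 1 (shift (Z.of_nat i) s) = m - i.
  apply: gap_unique; first by lia.
  - rewrite shift_shift.
    have -> : (Z.of_nat i + 1 * Z.of_nat (m - i).+1)%Z = Z.of_nat m.+1 by lia.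
    by rewrite Gm.
  - move=> j ji; rewrite shift_shift.
    have -> : (Z.of_nat i + 1 * Z.of_nat j.+1)%Z = Z.of_nat (i + j.+1) by lia.
    by apply: lo'; lia.
have e1 : (Z.of_nat i + - Z.of_nat i.-1.+1)%Z = 0%Z by lia.
have e2 : (Z.of_nat i + Z.of_nat (m - i).+1)%Z = Z.of_nat m.+1 by lia.
rewrite /= !shift_shift {2 4}/shift e1 e2 shift0 Gs Gm /shift e1 e2.
have -> : (i.-1 + (m - i)).+1 = m by lia.
rewrite /f; case: ltngtP => // [_|_|].
- by congr (the_filler _ _ _ _ _); lia.
- by congr (the_filler _ _ _ _ _); lia.
(* The ends are at most [B] apart, so their identifiers differ and the dummy label does not
   occur. *)
by move=> e; case: (@distinctV s 0%Z (Z.of_nat m.+1) Vs); lia.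
Qed.

(** Each position is at some distance i <= m from the last anchor [s0] weakly to its left, and all
    three claims are read off the filler of the block after [s0]. *)
Theorem fill_correct s : V s ->
  [/\ forall b, C (fill s b), cnode P (fill s false) (fill s true) &
      cedge P (fill s true) (fill (shift 1 s) false)].
Proof.
move=> Vs.
suff [s0 [i [l [m [l' [f [Vs0 Gs0 es]]]]]]] : exists s0 i l m l' f,
  [/\ V s0, G s0 = Some l & s = shift (Z.of_nat i) s0 /\ [/\ i <= m,
      G (shift (Z.of_nat m.+1) s0) = Some l', filler f (l true) (l' false) m &
      forall i b, 0 < i <= m -> fill (shift (Z.of_nat i) s0) b = f i b]].
  case: es => -> [im Gm [f0 fm fe fn fC] fE].
  have [Cl0 Cl1 nl] := G_label Vs0 Gs0.
  have fT : fill (shift (Z.of_nat i) s0) true = f i true.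
    by have [->|i0] := posnP i; [rewrite shift0 /fill Gs0 f0 | rewrite fE // i0].
  have fF : fill (shift 1 (shift (Z.of_nat i) s0)) false = f i.+1 false.
    rewrite shift_shift; have -> : (Z.of_nat i + 1)%Z = Z.of_nat i.+1 by lia.
    move: im; rewrite leq_eqVlt => /orP[/eqP ->|im]; last by rewrite fE.
    by rewrite /fill Gm fm.
  rewrite fT fF; have [i0|i0] := posnP i.
    rewrite -fT i0 shift0 /fill Gs0; split=> //; first by case.
    by have := fe 0 isT; rewrite f0.
  have ii : 0 < i <= m by rewrite i0.
  by split=> [b||]; rewrite ?fE //; [apply: fC | apply: fn | apply: fe].
case Gs: (G s) => [l|].
  have [m [l' [f [Gm ff _ fE]]]] := fill_block Vs Gs.
  by exists s, 0, l, m, l', f; rewrite shift0.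
have [gB] := @gapP (-1) s erefl Vs; set a := gap _ s => Ga lo.
set s0 := shift _ s in Ga; case Gs0: (G s0) Ga => [l|] // _.
have Vs0 : V s0 by apply: shiftV.
have [m [l' [f [Gm ff em fE]]]] := fill_block Vs0 Gs0.
have es : s = shift (Z.of_nat a.+1) s0.
  by rewrite /s0 shift_shift -[LHS]shift0; congr (shift _ s); lia.
exists s0, a.+1, l, m, l', f; split=> //; split=> //; split=> //.
(* Otherwise the block of [s0] would end at [s] or before it, at a position where [G] is
   undefined. *)
rewrite ltnNge; apply/negP => ma.
have : G (shift (Z.of_nat m.+1) s0) = None.
  rewrite /s0 shift_shift; have [e|ne] := eqVneq m a.
    by have -> : (-1 * Z.of_nat a.+1 + Z.of_nat m.+1)%Z = 0%Z by lia; rewrite shift0.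
  have -> : (-1 * Z.of_nat a.+1 + Z.of_nat m.+1)%Z = (-1 * Z.of_nat (a - m.+1).+1)%Z by lia.
  by apply: lo; lia.
by rewrite Gm.
Qed.

End Fill.

(** * Local maxima *)

Definition distinct (D : nat) (s : zseq) : Prop :=
  forall i j, (0 < Z.abs (i - j) <= Z.of_nat D)%Z -> s i <> s j.

Lemma distinct_shift D i s : distinct D s -> distinct D (shift i s).
Proof. by move=> h j l jl; apply: h; lia. Qed.

Lemma distinctW D D' s : D <= D' -> distinct D' s -> distinct D s.
Proof. by move=> le h i j ij; apply: h; lia. Qed.

Definition peak k (c : zseq) : bool :=
  all (fun j => (c (Z.of_nat j) < c 0%Z) && (c (- Z.of_nat j)%Z < c 0%Z)) (iota 1 k).

Lemma peakP k c : reflect (forall j, (0 < Z.abs j <= Z.of_nat k)%Z -> c j < c 0%Z) (peak k c).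
Proof.
apply: (iffP allP) => h j.
  move=> jk; have /andP[h1 h2] : (c (Z.of_nat (Z.to_nat (Z.abs j))) < c 0%Z) &&
     (c (- Z.of_nat (Z.to_nat (Z.abs j)))%Z < c 0%Z) by apply: h; rewrite mem_iota; lia.
  have [j0|j0] := Z_le_gt_dec 0 j.
    by move: h1; congr (c _ < _); lia.
  by move: h2; congr (c _ < _); lia.
by rewrite mem_iota => jk; rewrite !h //; lia.
Qed.

Lemma peak_local k : local k (peak k).
Proof.
move=> s s' e; apply: eq_in_all => j; rewrite mem_iota => jk.
by rewrite !e //; lia.
Qed.

Lemma peak_mirror k c : peak k (mirror c) = peak k c.
Proof.
apply: eq_all => j; rewrite /mirror /= andbC.
by congr ((c _ < _) && _); lia.
Qed.

Lemma peaks_sparse k c i j : peak k (shift i c) -> peak k (shift j c) ->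
  (0 < Z.abs (i - j) <= Z.of_nat k)%Z -> False.
Proof.
move=> /peakP pi /peakP pj ij.
have := pi (j - i)%Z; have := pj (i - j)%Z; rewrite /shift !Z.add_0_r.
have -> : (i + (j - i))%Z = j by lia.
have -> : (j + (i - j))%Z = i by lia.
move=> h1 h2; have l1 := h1 ltac:(lia); have l2 := h2 ltac:(lia).
by have := ltn_trans l1 l2; rewrite ltnn.
Qed.

(** Climb: a position that is not a peak has a larger colour within distance k, and the colour can
    grow fewer than Q times. *)
Lemma peak_near k Q (c : zseq) i : (forall i, c i < Q) -> distinct k c ->
  exists2 p, (Z.abs (p - i) <= Z.of_nat (k * Q))%Z & peak k (shift p c).
Proof.
move=> cQ dc.
suff : exists2 p, (Z.abs (p - i) <= Z.of_nat (k * (Q - c i)))%Z & peak k (shift p c).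
  case=> p hp pp; exists p => //; have : k * (Q - c i) <= k * Q by rewrite leq_mul2l leq_subr orbT.
  by move: hp; move: (k * (Q - c i)) (k * Q) => u v; lia.
move: {2}(Q - c i) (leqnn (Q - c i)) => N; elim: N i => [|N IH] i.
  by rewrite leqn0 subn_eq0 leqNgt cQ.
move=> iN; have [pk|npk] := boolP (peak k (shift i c)); first by exists i => //; rewrite Z.sub_diag; apply: Nat2Z.is_nonneg.
have [j jk cj] : exists2 j, (0 < Z.abs (j - i) <= Z.of_nat k)%Z & c i < c j.
  apply: NNPP => no; case/peakP: npk => j jk; rewrite /shift Z.add_0_r.
  case: (ltngtP (c (i + j)%Z) (c i)) => // h.
  - by case: no; exists (i + j)%Z => //; lia.
  - by case: (dc (i + j)%Z i) => //; lia.
have cjQ := cQ j.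
have [|p pj pp] := IH j; first by lia.
exists p => //; have : k * (Q - c j) + k <= k * (Q - c i).
  by rewrite -mulnSr leq_mul2l; apply/orP; right; lia.
by move: pj; move: (k * (Q - c i)) (k * (Q - c j)) => u v; lia.
Qed.

Definition rmax k (s : zseq) := \max_(j < k) s (Z.of_nat j.+1).
Definition lmax k (s : zseq) := \max_(j < k) s (- Z.of_nat j.+1)%Z.
Definition rightward k s := (lmax k s < rmax k s) && (s 0%Z < rmax k s).
Definition leftward k s := (rmax k s < lmax k s) && (s 0%Z < lmax k s).

Lemma rmax_ge k s j : (0 < j <= Z.of_nat k)%Z -> s j <= rmax k s.
Proof.
move=> jk; have h : (Z.to_nat j).-1 < k by lia.
have -> : s j = s (Z.of_nat (Ordinal h).+1) by congr s; rewrite /=; lia.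
exact: (@leq_bigmax _ (fun j : 'I_k => s (Z.of_nat j.+1)) (Ordinal h)).
Qed.

Lemma lmax_mirror k s : lmax k s = rmax k (mirror s).
Proof. by []. Qed.

Lemma lmax_ge k s j : (0 < - j <= Z.of_nat k)%Z -> s j <= lmax k s.
Proof.
move=> jk; rewrite lmax_mirror; have -> : s j = mirror s (- j)%Z by rewrite /mirror; congr s; lia.
exact: rmax_ge.
Qed.

Lemma rmax_attained k s : 0 < k -> exists2 j, (0 < j <= Z.of_nat k)%Z & rmax k s = s j.
Proof.
move=> k0; have k1 : 0 < #|'I_k| by rewrite card_ord.
have [j ej] := eq_bigmax (fun j : 'I_k => s (Z.of_nat j.+1)) k1.
by exists (Z.of_nat j.+1) => //; have := ltn_ord j; lia.
Qed.

Lemma rmax_lt k s m : 0 < k -> (forall j, (0 < j <= Z.of_nat k)%Z -> s j < m) -> rmax k s < m.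
Proof. by move=> k0 h; have [j jk ->] := rmax_attained s k0; apply: h. Qed.

Lemma lmax_lt k s m : 0 < k -> (forall j, (0 < - j <= Z.of_nat k)%Z -> s j < m) -> lmax k s < m.
Proof. by move=> k0 h; rewrite lmax_mirror; apply: rmax_lt => // j jk; apply: h; lia. Qed.

Lemma rightward_mirror k s : rightward k (mirror s) = leftward k s.
Proof. by rewrite /rightward lmax_mirror mirrorK /leftward (lmax_mirror k s). Qed.

Lemma leftward_mirror k s : leftward k (mirror s) = rightward k s.
Proof. by rewrite -rightward_mirror mirrorK. Qed.

Lemma rmax_local k : local k (rmax k).
Proof. by move=> s s' e; apply: eq_bigr => j _; apply: e; have := ltn_ord j; lia. Qed.

Lemma rightward_local k : local k (rightward k).
Proof.
move=> s s' e; rewrite /rightward !lmax_mirror (rmax_local e) e; last lia.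
by rewrite (@rmax_local k (mirror s) (mirror s')) // => j jk; apply: e; lia.
Qed.

Lemma leftward_local k : local k (leftward k).
Proof.
move=> s s' e; rewrite -!rightward_mirror; apply: rightward_local => j jk.
by apply: e; lia.
Qed.

(** The largest of the 2k + 1 identifiers around a node is unique and stands at the centre, to the
    right or to the left. *)
Lemma trichotomy k s : 0 < k -> distinct k.*2 s -> [|| peak k s, rightward k s | leftward k s].
Proof.
move=> k0 ds.
have [i ik ei] := rmax_attained s k0.
have [j jk ej] := rmax_attained (mirror s) k0; rewrite -lmax_mirror /mirror in ej.
have ne : rmax k s <> lmax k s by rewrite ei ej; apply: ds; lia.
have n0 : rmax k s <> s 0%Z by rewrite ei; apply: ds; lia.
have n1 : lmax k s <> s 0%Z by rewrite ej; apply: ds; lia.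
have [p|np] := boolP (peak k s) => //=; rewrite /rightward /leftward.
suff : (s 0%Z < rmax k s) || (s 0%Z < lmax k s) by clear -ne; lia.
apply/negPn/negP; rewrite negb_or -!leqNgt => /andP[h1 h2]; case/peakP: np => l lk.
have [l0|l0] := Z_le_gt_dec l 0.
  by apply: (@leq_ltn_trans (lmax k s)); [apply: lmax_ge; lia | clear -h2 n1; lia].
by apply: (@leq_ltn_trans (rmax k s)); [apply: rmax_ge; lia | clear -h1 n0; lia].
Qed.

Lemma right_not_left k s : rightward k s -> ~~ leftward k s.
Proof. by move=> /andP[h _]; rewrite /leftward negb_and -leqNgt (ltnW h). Qed.

(** If the next node pointed left, the maximum on its left, taken over the present node and part of
    what lies left of it, would be both below and above the maximum on the right of the present
    node. *)
Lemma rightward_step k s : 0 < k -> distinct k.*2 s ->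
  rightward k s -> ~~ peak k (shift 1 s) -> rightward k (shift 1 s).
Proof.
move=> k0 ds /andP[h1 h2] np.
have := trichotomy k0 (distinct_shift (i := 1) ds); rewrite (negbTE np) /=.
case/orP=> // /andP[h3 h4].
have : lmax k (shift 1 s) < rmax k s.
  apply: lmax_lt => // j jk; rewrite /shift.
  have [->|j1] := Z.eq_dec j (-1); first exact: h2.
  by apply: leq_ltn_trans h1; apply: lmax_ge; lia.
rewrite ltnNge => /negP[]; apply: ltnW; apply: rmax_lt => // j jk.
have [->|j1] := Z.eq_dec j 1; first exact: h4.
apply: leq_ltn_trans h3; have -> : s j = shift 1 s (j - 1)%Z by rewrite /shift; congr s; lia.
by apply: rmax_ge; lia.
Qed.

Lemma rightward_run k s n : 0 < k -> distinct k.*2 s -> rightward k s ->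
  (forall i, i <= n -> ~~ peak k (shift (Z.of_nat i) s)) -> rightward k (shift (Z.of_nat n) s).
Proof.
move=> k0 ds rs; elim: n => [|n IH] np; first by rewrite shift0.
have -> : shift (Z.of_nat n.+1) s = shift 1 (shift (Z.of_nat n) s).
  by rewrite shift_shift; congr (shift _ s); lia.
apply: rightward_step => //; first exact: distinct_shift.
  by apply: IH => i /leqW /np.
have -> : shift 1 (shift (Z.of_nat n) s) = shift (Z.of_nat n.+1) s.
  by rewrite shift_shift; congr (shift _ s); lia.
exact: np.
Qed.

Lemma leftward_run k s n : 0 < k -> distinct k.*2 s -> leftward k s ->
  (forall i, i <= n -> ~~ peak k (shift (- Z.of_nat i) s)) -> leftward k (shift (- Z.of_nat n) s).
Proof.
move=> k0 ds ls np; rewrite -rightward_mirror -shift_mirror; apply: rightward_run => //.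
- by move=> i j ij; apply: ds; lia.
- by move=> i /np; rewrite shift_mirror peak_mirror.
Qed.

(* Leftward positions precede rightward ones unless a peak lies in between, so
   the direction at the middle of a peak-free interval propagates to one half. *)
Lemma uniform_half k s w : 0 < k -> distinct k.*2 s ->
  (forall i, (Z.abs i <= Z.of_nat w.*2)%Z -> ~~ peak k (shift i s)) ->
  (forall i, (0 <= i <= Z.of_nat w.*2)%Z -> rightward k (shift i s)) \/
  (forall i, (0 <= - i <= Z.of_nat w.*2)%Z -> leftward k (shift i s)).
Proof.
move=> k0 ds np.
have := trichotomy k0 ds; rewrite -{1}[s]shift0 (negbTE (np 0%Z _)) /=; last by lia.
case/orP => h; [left|right] => i hi.
  have -> : i = Z.of_nat (Z.to_nat i) by lia.
  by apply: rightward_run => // j ji; apply: np; lia.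
have -> : i = (- Z.of_nat (Z.to_nat (- i)))%Z by lia.
by apply: leftward_run => // j ji; apply: np; lia.
Qed.

(** * Colour reduction *)

Definition bit i x := odd (x %/ 2 ^ i).

Lemma bits_inj m x y : x < 2 ^ m -> y < 2 ^ m ->
  (forall i, i < m -> bit i x = bit i y) -> x = y.
Proof.
elim: m x y => [|m IH] x y; first by rewrite expn0 !ltnS !leqn0 => /eqP-> /eqP->.
move=> xm ym h; rewrite -[x]odd_double_half -[y]odd_double_half.
have := h 0 isT; rewrite /bit expn0 !divn1 => ->; congr (_ + _.*2).
apply: IH => [||i im]; try by rewrite -divn2 ltn_divLR // -expnSr.
by have := h i.+1 im; rewrite /bit expnS !divnMA -!divn2.
Qed.

Section Step.
Variables (k m : nat).

Definition dif x y := find (fun i => bit i x != bit i y) (iota 0 m).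

Lemma dif_le x y : dif x y <= m.
Proof. by rewrite -[X in _ <= X](size_iota 0); apply: find_size. Qed.

Lemma difP x y : x < 2 ^ m -> y < 2 ^ m -> x <> y -> bit (dif x y) x != bit (dif x y) y.
Proof.
move=> xm ym ne; pose a i := bit i x != bit i y.
have h : has a (iota 0 m).
  apply/negPn/negP => /hasPn nh; apply: ne; apply: (bits_inj xm ym) => i im.
  by apply/eqP; rewrite -[_ == _]negbK; apply: nh; rewrite mem_iota.
have := nth_find 0 h; rewrite nth_iota ?add0n //.
by move: h; rewrite has_find size_iota.
Qed.

Notation elt := ('I_m.+1 * bool)%type.
Notation nbr := (bool * 'I_k)%type.

Definition offset (j : nbr) : Z :=
  if j.1 then Z.of_nat j.2.+1 else (- Z.of_nat j.2.+1)%Z.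

Definition elem x y : elt := (inord (dif x y), bit (dif x y) x).

(** Cole-Vishkin pairs (index of the first differing bit, own bit) towards the 2k nearest nodes.
    They are collected in a set because left and right cannot be told apart. *)
Definition colset (c : zseq) : {set elt} :=
  [set elem (c 0%Z) (c (offset j)) | j in [set: nbr]].

(** A set of at most 2k pairs is numbered by the rank of a function enumerating it, which keeps the
    number of codes polynomial in m for fixed k. *)
Definition code (S : {set elt}) : nat :=
  if [pick f : {ffun nbr -> elt} | [set f j | j in [set: nbr]] == S] is Some f
  then enum_rank f else 0.

Definition colstep (c : zseq) : nat := code (colset c).

Lemma colstep_lt c : colstep c < (m.+1 * 2) ^ (2 * k).
Proof.
rewrite /colstep /code; case: pickP => [f _|_]; last by rewrite expn_gt0 muln_gt0.
apply: leq_trans (ltn_ord _) _.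
by rewrite card_ffun !card_prod !card_ord card_bool mulnC.
Qed.

Lemma colstep_mirror c : colstep (mirror c) = colstep c.
Proof.
rewrite /colstep; congr code; rewrite /colset /mirror.
pose sw (j : nbr) : nbr := (~~ j.1, j.2).
have off j : (- offset j)%Z = offset (sw j) by case: j => [[] i].
apply/setP => e; apply/imsetP/imsetP => -[j _ ->]; exists (sw j) => //.
  by rewrite -off.
by rewrite -off Z.opp_involutive.
Qed.

Lemma colstep_local : local k colstep.
Proof.
move=> s s' e; rewrite /colstep; congr code; apply: eq_in_imset => -[b i] _.
by rewrite !e //; have := ltn_ord i; case: b => /=; lia.
Qed.

Lemma code_inj c c' : colstep c = colstep c' -> colset c = colset c'.
Proof.
rewrite /colstep /code.
have real (d : zseq) : [set [ffun j => elem (d 0%Z) (d (offset j))] j | j in [set: nbr]] == colset d.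
  by apply/eqP; apply: eq_imset => j; rewrite ffunE.
case: pickP => [f /eqP <-|/(_ [ffun j => elem (c 0%Z) (c (offset j))])]; last by rewrite real.
case: pickP => [g /eqP <-|/(_ [ffun j => elem (c' 0%Z) (c' (offset j))])]; last by rewrite real.
by move/val_inj/enum_rank_inj ->.
Qed.

(* If [i] and [j] had the same set, the element that [i] contributes because of [j]
   would be one of those of [j], yet [i] and [j] differ at that very bit. *)
Lemma colstep_proper (c : zseq) i j :
  (forall i, c i < 2 ^ m) ->
  c i <> c j -> (0 < Z.abs (i - j) <= Z.of_nat k)%Z ->
  colstep (shift i c) <> colstep (shift j c).
Proof.
move=> lt ne ij /code_inj e.
have [j0 ej] : exists j0, (i + offset j0)%Z = j.
  have [h|h] := Z_lt_le_dec i j.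
    have hk : (Z.to_nat (j - i)).-1 < k by lia.
    by exists (true, Ordinal hk); rewrite /offset /=; lia.
  have hk : (Z.to_nat (i - j)).-1 < k by lia.
  by exists (false, Ordinal hk); rewrite /offset /=; lia.
have : elem (c i) (c j) \in colset (shift i c).
  by apply/imsetP; exists j0; rewrite /shift ?Z.add_0_r ?ej.
rewrite e => /imsetP[j1 _]; rewrite /shift Z.add_0_r => -[].
move/(congr1 val); rewrite /= !inordK ?ltnS ?dif_le // => ed eb.
by have := difP (lt i) (lt j) ne; rewrite eb ed eqxx.
Qed.

End Step.

(** * Two algorithms *)

Definition correct (P : NELCL) (C : pred (gam P)) (F : zseq -> bool -> gam P) (s : zseq) : Prop :=
  [/\ forall b, C (F s b), cnode P (F s false) (F s true) &
      cedge P (F s true) (F (shift 1 s) false)].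

Definition ball w (D : zseq -> bool) (s : zseq) : bool :=
  all (fun j => D (shift (Z.of_nat j) s) && D (shift (- Z.of_nat j) s)) (iota 0 w.+1).

Lemma ballP w (D : zseq -> bool) s : reflect (forall j, (Z.abs j <= Z.of_nat w)%Z -> D (shift j s)) (ball w D s).
Proof.
apply: (iffP allP) => h j jw.
  have /andP[h1 h2] : D (shift (Z.of_nat (Z.to_nat (Z.abs j))) s) &&
     D (shift (- Z.of_nat (Z.to_nat (Z.abs j))) s) by apply: h; rewrite mem_iota; lia.
  have [j0|j0] := Z_le_gt_dec 0 j.
    by move: h1; congr (is_true (D (shift _ s))); lia.
  by move: h2; congr (is_true (D (shift _ s))); lia.
by move: jw; rewrite mem_iota => jw; rewrite !h //; lia.
Qed.

Lemma ball_local t w (D : zseq -> bool) : local t D -> local (t + w) (ball w D).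
Proof.
move=> lD s s' e; apply: eq_in_all => j; rewrite mem_iota => jw.
by congr andb; apply: lD => i hi; rewrite /shift; apply: e; lia.
Qed.

Lemma ball_mirror w (D D' : zseq -> bool) s : (forall s, D (mirror s) = D' s) -> ball w D (mirror s) = ball w D' s.
Proof.
move=> h; apply: eq_all => j; rewrite !shift_mirror !h andbC Z.opp_involutive //.
Qed.

(** * Constant-round algorithm in the presence of a loop *)

Section Loop.
Variables (P : NELCL) (C : pred (gam P)) (K : nat) (a b : gam P).
Hypotheses (symP : symmetricNE P) (gC : good P C K).
Hypotheses (Ca : C a) (Cb : C b) (n_ab : cnode P a b) (e_ba : cedge P b a).

Let w := K.+1.
Let k := (8 * w).+2.

Definition loop_label (x : bool) := if x then b else a.

(** Agreement on a whole ball keeps anchors of opposite directions more than [w] apart. *)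
Definition runs (s : zseq) : option (bool -> gam P) :=
  if ball w (rightward k) s then Some loop_label
  else if ball w (leftward k) s then Some (flip loop_label) else None.

Lemma balls_exclusive i j s : (Z.abs (i - j) <= Z.of_nat w)%Z ->
  ball w (rightward k) (shift i s) -> ball w (leftward k) (shift j s) -> False.
Proof.
move=> ij /ballP /(_ (j - i)%Z ltac:(lia)) h1 /ballP /(_ 0%Z ltac:(lia)) h2.
rewrite shift0 in h2; rewrite shift_shift in h1.
have e : (i + (j - i))%Z = j by lia.
by rewrite e in h1; have := right_not_left h1; rewrite h2.
Qed.

Lemma runs_local : local (k + w) runs.
Proof.
move=> s s' e; rewrite /runs (ball_local (@rightward_local k) e).
by rewrite (ball_local (@leftward_local k) e).
Qed.

Lemma runs_mirror s : runs (mirror s) = omap (@flip P) (runs s).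
Proof.
rewrite /runs (ball_mirror _ _ (@rightward_mirror k)) (ball_mirror _ _ (@leftward_mirror k)).
case: ifP => L; case: ifP => R //=.
  by case: (@balls_exclusive 0 0 s) => //; rewrite ?shift0 //; lia.
by congr Some; apply: functional_extensionality => -[].
Qed.

Lemma runsP s l : runs s = Some l ->
  (ball w (rightward k) s /\ l = loop_label) \/ (ball w (leftward k) s /\ l = flip loop_label).
Proof.
rewrite /runs; case: ifP => R; first by case=> <-; left.
by case: ifP => // L; case=> <-; right.
Qed.

Lemma runs_dense e s : (Z.abs e = 1)%Z -> distinct k.*2 s ->
  exists2 j, j < k & runs (shift (e * Z.of_nat j.+1) s) <> None.
Proof.
move=> e1 ds.
suff [j jk nj] : exists2 j, (0 < e * j <= Z.of_nat k)%Z & runs (shift j s) <> None.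
  exists (Z.to_nat (e * j)).-1; first by lia.
  by move: nj; congr (runs (shift _ s) <> None); nia.
have k0 : 0 < k by [].
suff [x [x0 x1 np]] : exists x, [/\ (Z.of_nat w.*2 < e * x)%Z,
    (e * x + Z.of_nat w.*2 <= Z.of_nat k)%Z &
    forall i, (Z.abs i <= Z.of_nat w.*2)%Z -> ~~ peak k (shift i (shift x s))].
  have [h|h] := uniform_half k0 (distinct_shift (i := x) ds) np.
    exists (x + Z.of_nat w)%Z; first by nia.
    rewrite /runs; suff -> : ball w (rightward k) (shift (x + Z.of_nat w) s) by [].
    apply/ballP => j jw; have := h (Z.of_nat w + j)%Z ltac:(lia).
    by rewrite !shift_shift Z.add_assoc.
  exists (x - Z.of_nat w)%Z; first by nia.
  rewrite /runs; case: ifP => // _.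
  suff -> : ball w (leftward k) (shift (x - Z.of_nat w) s) by [].
  apply/ballP => j jw; have := h (- Z.of_nat w + j)%Z ltac:(lia).
  by rewrite !shift_shift; congr (is_true (leftward k (shift _ s))); lia.
(* The windows of radius 2w around [x1] and [x2] tile the distances 1 to k = 8w + 2. Peaks in both
   would be less than k apart, so one window has no peak. *)
pose x1 := (e * Z.of_nat (2 * w + 1))%Z; pose x2 := (e * Z.of_nat (6 * w + 2))%Z.
apply: NNPP => no.
have get x : (Z.of_nat w.*2 < e * x)%Z -> (e * x + Z.of_nat w.*2 <= Z.of_nat k)%Z ->
    exists2 i, (Z.abs i <= Z.of_nat w.*2)%Z & peak k (shift (x + i) s).
  move=> h1 h2; apply: NNPP => no'; apply: no; exists x; split=> // i hi.
  by apply/negP; rewrite shift_shift => pk; apply: no'; exists i.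
have [i hi pi] := get x1 ltac:(nia) ltac:(nia).
have [j hj pj] := get x2 ltac:(nia) ltac:(nia).
by apply: (peaks_sparse pi pj); rewrite /x1 /x2 /k; nia.
Qed.

(** Suppose a hole is shorter than K. If both ends point the same way, their balls of radius [w]
    cover the ball of the first node inside, which is then an anchor; if not, the balls overlap in a
    node with both directions. *)
Lemma runs_sparse s m : runs s <> None -> runs (shift (Z.of_nat m.+1) s) <> None ->
  (forall i, 0 < i <= m -> runs (shift (Z.of_nat i) s) = None) -> 0 < m -> K <= m.
Proof.
move=> h0 h1 hi m0; rewrite leqNgt; apply/negP => mK.
have hi1 : runs (shift 1 s) = None by apply: (hi 1).
case E0: (runs s) h0 => [l|] // _; case E1: (runs _) h1 => [l'|] // _.
have mw : m.+1 <= w by rewrite /w; lia.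
have cover D (B0 : ball w D s) (B1 : ball w D (shift (Z.of_nat m.+1) s)) : ball w D (shift 1 s).
  apply/ballP => j jw; rewrite shift_shift.
  have [h|h] := Z_le_gt_dec (1 + j) (Z.of_nat w); first by apply: (elimT (ballP w D s)) => //; lia.
  have := elimT (ballP _ _ _) B1 (1 + j - Z.of_nat m.+1)%Z ltac:(lia).
  by rewrite shift_shift; congr (is_true (D (shift _ s))); lia.
have x0 : shift 0 s = s by apply: shift0.
case: (runsP E0) => -[B0 _]; case: (runsP E1) => -[B1 _].
- by move: hi1; rewrite /runs (cover _ B0 B1).
- by case: (@balls_exclusive 0 (Z.of_nat m.+1) s); rewrite ?x0 //; lia.
- by case: (@balls_exclusive (Z.of_nat m.+1) 0 s); rewrite ?x0 //; lia.
- by move: hi1; rewrite /runs (cover _ B0 B1); case: ifP.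
Qed.

Lemma loop_algorithm : exists t D F,
  [/\ local t F, equivariant F & forall s, distinct D s -> correct C F s].
Proof.
case: (symP) => se [sn _].
exists (k + w + k.+1), k.*2, (fill C runs k a); split.
- exact: fill_local runs_local.
- exact: fill_equivariant runs_mirror.
move=> s ds; apply: (@fill_correct _ _ _ symP gC _ _ _ (distinct k.*2)) => //.
- by move=> i s'; apply: distinct_shift.
- by move=> s' i j d' ij; apply: d'; lia.
- by move=> s' l _ /runsP[] [_ ->]; rewrite /flip /= ?(sn b).
- move=> s' l l' _ /runsP[] [B0 ->] /runsP[] [B1 ->]; rewrite /flip //= ?(se a) //.
  + by case: (@balls_exclusive 0 1 s'); rewrite ?shift0 //; lia.
  + by case: (@balls_exclusive 1 0 s'); rewrite ?shift0 //; lia.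
- by move=> e s' e1; apply: runs_dense.
- by move=> s' m _; apply: runs_sparse.
Qed.

End Loop.

Definition colours (col : zseq -> nat) (s : zseq) : zseq := fun i => col (shift i s).

Lemma shift_colours col i s : shift i (colours col s) = colours col (shift i s).
Proof. by apply: functional_extensionality => j; rewrite /shift /colours -shift_shift. Qed.

Lemma mirror_colours col s : (forall s, col (mirror s) = col s) ->
  colours col (mirror s) = mirror (colours col s).
Proof.
by move=> h; apply: functional_extensionality => j; rewrite /mirror /colours shift_mirror h.
Qed.

Lemma colours_local t t' X col (F : zseq -> X) : local t col -> local t' F ->
  local (t + t') (fun s => F (colours col s)).
Proof.
move=> lc lF s s' e; apply: lF => j hj; apply: lc => i hi; rewrite /shift; apply: e; lia.
Qed.

(** * Anchors at the local maxima of a colouring *)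

Section Ruling.
Variables (P : NELCL) (C : pred (gam P)) (K : nat).
Hypotheses (symP : symmetricNE P) (gC : good P C K).
Variables (V : zseq -> Prop) (col : zseq -> nat) (t Q : nat).
(** Peaks are more than k apart, which leaves room for fillers, and a peak lies within k Q of every
    position, so the next one in a given direction is at most 2 k Q + 1 away. *)
Let k := K.+1.
Let B := (k * Q).*2.+2.
Hypothesis shiftV : forall i s, V s -> V (shift i s).
Hypothesis distinctV : forall s, V s -> distinct B s.
Hypothesis col_local : local t col.
Hypothesis col_mirror : forall s, col (mirror s) = col s.
Hypothesis col_lt : forall s, V s -> col s < Q.
Hypothesis col_proper : forall s j, V s -> (0 < Z.abs j <= Z.of_nat k)%Z ->
  col s <> col (shift j s).

Lemma colours_distinct s : V s -> distinct k (colours col s).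
Proof.
move=> Vs i j ij; rewrite /colours.
have -> : shift j s = shift (j - i) (shift i s).
  by rewrite shift_shift; congr (shift _ s); lia.
by apply: col_proper; [apply: shiftV | lia].
Qed.

(** A peak has no orientation of its own, so the identifiers of its two neighbours decide which way
    its label is read. *)
Definition rulers (l : bool -> gam P) (s : zseq) : option (bool -> gam P) :=
  if peak k (colours col s) then
    if s (-1)%Z < s 1%Z then Some l
    else if s 1%Z < s (-1)%Z then Some (flip l) else None
  else None.

Lemma rulers_peak l s : V s -> rulers l s <> None <-> peak k (colours col s).
Proof.
move=> Vs; rewrite /rulers; case: ifP => // _.
have ne : s (-1)%Z <> s 1%Z by apply: (distinctV Vs); rewrite /B; lia.
by case: ltngtP.
Qed.

Lemma ruling_algorithm : exists F,
  [/\ local (t + k + 2 + B) F, equivariant F & forall s, V s -> correct C F s].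
Proof.
case: (symP) => se [sn _].
have [[x Cx] flex] := gC.
(* A walk with at least one step supplies a pair (u, z) of labels in [C] that is allowed at a
   node. *)
have [u [Cu exu w]] := flex x x K.+1 Cx Cx (leqnSn K).
case: w => z [_ [Cz _ n_uz _ _]].
pose l (b : bool) := if b then z else u.
have pk s : V s -> rulers l s <> None -> peak k (colours col s) by move=> Vs /(rulers_peak l Vs).
exists (fill C (rulers l) B.-1 u); split.
- rewrite -addSnnS; apply: fill_local => s s' e; rewrite /rulers.
  rewrite !e; try lia.
  suff -> : peak k (colours col s) = peak k (colours col s') by [].
  apply: peak_local => j jk; apply: col_local => i hi; rewrite /shift; apply: e; lia.
- apply: fill_equivariant => s; rewrite /rulers mirror_colours // peak_mirror /mirror /=.
  case: ifP => //= _; case: ltngtP => //= _; congr Some.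
  by apply: functional_extensionality => -[].
move=> s Vs; apply: (@fill_correct _ _ _ symP gC _ _ _ V) => //.
- by move=> s' i j V' ij; apply: (distinctV V'); rewrite /B in ij *; lia.
- move=> s' l0 V'; rewrite /rulers; case: ifP => // _.
  by case: ltngtP => // _ [<-]; split; rewrite /flip /= ?(sn z).
- move=> s' l0 l1 V' e0 e1; exfalso.
  have p0 : peak k (shift 0 (colours col s')) by rewrite shift0; apply: pk; rewrite ?e0.
  have p1 : peak k (shift 1 (colours col s')).
    by rewrite shift_colours; apply: pk; rewrite ?e1 //; apply: shiftV.
  by apply: (peaks_sparse p0 p1); lia.
- move=> e s' e1 V'.
  (* The search starts k Q + 1 steps away, so a peak within k Q of there lies strictly in direction
     [e]. *)
  have [p hp pp] := @peak_near k Q (colours col s') (e * Z.of_nat (k * Q).+1)%Z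
    (fun i => col_lt (shiftV i V')) (colours_distinct V').
  exists (Z.to_nat (e * p)).-1; first by rewrite /B; nia.
  have -> : (e * Z.of_nat (Z.to_nat (e * p)).-1.+1)%Z = p by nia.
  by apply/rulers_peak; [apply: shiftV | rewrite -shift_colours].
move=> s' m V' h0 h1 _ m0; rewrite leqNgt; apply/negP => mK.
have p0 : peak k (shift 0 (colours col s')) by rewrite shift0; apply: pk.
have p1 : peak k (shift (Z.of_nat m.+1) (colours col s')).
  by rewrite shift_colours; apply: pk => //; apply: shiftV.
by apply: (peaks_sparse p0 p1); rewrite /k; lia.
Qed.

End Ruling.

Definition proper_colouring (V : zseq -> Prop) k t (col : zseq -> nat) : Prop :=
  [/\ local t col, forall s, col (mirror s) = col s &
      forall s j, V s -> (0 < Z.abs j <= Z.of_nat k)%Z -> col s <> col (shift j s)].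

Lemma leq_expl e m n : m <= n -> m ^ e <= n ^ e.
Proof. by case: e => // e; rewrite leq_exp2r. Qed.

(** * Iterated colour reduction *)

Section Reduction.
Variables (V : zseq -> Prop) (k E : nat).
Hypothesis shiftV : forall i s, V s -> V (shift i s).
Hypothesis kE : 2 * k < E.

(** From this value of L on, the constant factor (4E + 2)^(2k) in [shrink] is at most L and is
    absorbed because 2k < E. *)
Definition stop_log := (4 * E + 2) ^ (2 * k).
Definition palette := (2 ^ stop_log.+1) ^ E.

Lemma colstep_colouring m t col : proper_colouring V k t col ->
  (forall s, V s -> col s < 2 ^ m) ->
  proper_colouring V k (t + k) (fun s => colstep k m (colours col s)).
Proof.
case=> lc mc pc bc; split.
- exact: colours_local lc (@colstep_local k m).
- by move=> s; rewrite mirror_colours // colstep_mirror.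
move=> s j Vs jk; rewrite -shift_colours -[X in colstep _ _ X]shift0.
apply: colstep_proper; last by lia.
- by move=> i; apply/bc/shiftV.
- by rewrite /colours shift0; apply: pc.
Qed.

Lemma shrink L : stop_log <= L -> ((E * L.+1).+1 * 2) ^ (2 * k) <= L ^ E.
Proof.
rewrite /stop_log => h.
have L0 : 0 < L by apply: leq_trans h; rewrite expn_gt0; lia.
apply: (@leq_trans (((4 * E + 2) * L) ^ (2 * k))).
  by apply: leq_expl; nia.
rewrite expnMn; apply: (@leq_trans (L ^ (2 * k).+1)).
  by rewrite expnS leq_mul2r h orbT.
by rewrite leq_pexp2l.
Qed.

(* Invariant: at most [M ^ E] colours, where [M] runs through the iterated logarithms. *)
Lemma colour_reduction fuel M t col : M <= fuel ->
  proper_colouring V k t col -> (forall s, V s -> col s < M ^ E) ->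
  exists col', proper_colouring V k (t + k * logstar_rec fuel M) col' /\
    forall s, V s -> col' s < palette.
Proof.
elim: fuel M t col => [|fuel IH] M t col Mf pc bc.
  exists col; split; first by rewrite muln0 addn0.
  move=> s /bc; move: Mf; rewrite leqn0 => /eqP ->; rewrite exp0n //; lia.
have [lt|ge] := ltnP (trunc_log 2 M) stop_log.
  exists col; split.
    by case: pc => lc mc pc; split=> //; apply: localW lc; apply: leq_addr.
  move=> s /bc lt'; apply: leq_trans lt' _; apply: leq_expl.
  apply: leq_trans (ltnW (@trunc_log_ltn 2 M isT)) _.
  by rewrite leq_pexp2l // ltnS ltnW.
set L := trunc_log 2 M in ge *.
have L0 : 0 < L by apply: leq_trans ge; rewrite expn_gt0; lia.
have M0 : 0 < M by move: L0; rewrite /L; case: (M).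
have LM : L < M by apply: leq_trans (ltn_expl _ (ltnSn 1)) _; apply: trunc_logP.
have M1 : (M <= 1) = false by lia.
(* The M^E colours fit into E (L + 1) bits, and by [shrink] one step leaves at most L^E colours. *)
have b2 s : V s -> col s < 2 ^ (E * L.+1).
  move=> /bc lt'; apply: leq_trans lt' _; rewrite mulnC expnM; apply: leq_expl.
  exact/ltnW/trunc_log_ltn.
have := IH L _ _ _ (colstep_colouring pc b2).
case; first by lia.
  by move=> s Vs; apply: leq_trans (colstep_lt _ _ _) _; apply: shrink.
move=> col' [pc' bc']; exists col'; split=> //.
by rewrite /= M1 mulnS addnA.
Qed.

End Reduction.

Lemma colour_algorithm P (C : pred (gam P)) K c : symmetricNE P -> good P C K ->
  exists t D, forall n, 0 < n -> exists F,
    [/\ local (t + t * logstar n) F, equivariant F &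
        forall s, distinct D s -> (forall i, s i < n ^ c) -> correct C F s].
Proof.
(* The exponent E exceeds 2k and is at least c, so the identifiers themselves are the initial
   colouring with n^E colours. *)
move=> symP gC; pose k := K.+1; pose E := c + (2 * k).+1.
have kE : 2 * k < E by rewrite /E; lia.
pose B := (k * palette k E).*2.+2.
exists (k + 2 + B), (maxn B k) => n n0.
pose V s := distinct (maxn B k) s /\ forall i, s i < n ^ E.
have shiftV i s : V s -> V (shift i s).
  by case=> h1 h2; split; [apply: distinct_shift | move=> j; apply: h2].
have pc0 : proper_colouring V k 0 (fun s => s 0%Z).
  split=> // [s s' e|s j [ds _] jk]; first by apply: e.
  by rewrite /shift Z.add_0_r; apply: ds; lia.
have [s [_ h]|col [[lc mc pc] bc]] := colour_reduction shiftV kE (leqnn n) pc0.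
  exact: h.
have dV s : V s -> distinct B s by case=> ds _; apply: distinctW ds; rewrite leq_maxl.
have [F [lF eF cF]] := ruling_algorithm symP gC shiftV dV lc mc bc pc.
exists F; split=> //.
  apply: localW lF; rewrite -/(logstar n) -/k -/B add0n.
  have : k * logstar n <= (k + 2 + B) * logstar n by rewrite leq_mul2r; lia.
  lia.
move=> s ds sn; apply: cF; split=> // i; apply: leq_trans (sn i) _.
by rewrite leq_pexp2l // leq_addr.
Qed.

(** * The restricted problem and its mendability *)

Section Restriction.
Variables (P : NELCL) (symP : symmetricNE P) (C : pred (gam P)) (r : nat).
Local Notation R := (r.+1).

(* Short cycles, which the verifier recognises by [o], accept every solution of [P]. *)
Definition restricted_psi (f : 'I_(R.*2.+1) -> bool -> gam P) (o : option nat) : bool :=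
  let l := f (inord r) in let c := f (inord r.+1) in let s := f (inord r.+2) in
  [&& cnode P (c false) (c true), cedge P (l true) (c false), cedge P (c true) (s false) &
      (o == None) ==> (C (c false) && C (c true))].

Lemma restricted_psi_refl f o : restricted_psi (reflectL f) o = restricted_psi f o.
Proof.
case: symP => se [sn _]; rewrite /restricted_psi /reflectL.
have e0 : rev_ord (inord r : 'I_(R.*2.+1)) = inord r.+2.
  by apply: val_inj; rewrite /= !inordK; lia.
have e1 : rev_ord (inord r.+1 : 'I_(R.*2.+1)) = inord r.+1.
  by apply: val_inj; rewrite /= !inordK; lia.
have e2 : rev_ord (inord r.+2 : 'I_(R.*2.+1)) = inord r.
  by apply: val_inj; rewrite /= !inordK; lia.
rewrite e0 e1 e2 /= sn (se (f (inord r.+2) false)) (se (f (inord r.+1) false)).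
by rewrite [C _ && C _]andbC; congr andb; rewrite andbCA.
Qed.

Definition restricted : LCL (gam P) :=
  {| rad := R; psi := restricted_psi; psi_refl := restricted_psi_refl |}.

(** The map [w] is the identity for full labellings and [Some] for partial ones; the last clause
    then says that the whole ball is labelled. *)
Lemma ball_labels (X Y : Type) (w : Y -> X) n (lam : 'I_n -> X) (u : 'I_n)
    (f : 'I_(R.*2.+1) -> Y) :
  (forall k : 'I_(R.*2.+1), lam (cyc u k R) = w (f k)) ->
  [/\ lam (at_ u (-1)) = w (f (inord r)), lam u = w (f (inord r.+1)),
      lam (at_ u 1) = w (f (inord r.+2)) &
      forall d, (Z.abs d <= Z.of_nat R)%Z -> exists y, lam (at_ u d) = w y].
Proof.
move=> h; have hd d : (Z.abs d <= Z.of_nat R)%Z ->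
    lam (at_ u d) = w (f (inord (Z.to_nat (d + Z.of_nat R)))).
  move=> dR; rewrite -h cycE inordK; last by lia.
  by congr (lam (at_ u _)); lia.
have e0 : Z.to_nat (-1 + Z.of_nat R) = r by lia.
have e1 : Z.to_nat (0 + Z.of_nat R) = r.+1 by lia.
have e2 : Z.to_nat (1 + Z.of_nat R) = r.+2 by lia.
split.
- by rewrite hd ?e0 //; lia.
- by rewrite -{1}[u]at0 hd ?e1 //; lia.
- by rewrite hd ?e2 //; lia.
by move=> d dR; rewrite hd //; eexists.
Qed.

Definition happy n (lam : 'I_n -> bool -> gam P) (u : 'I_n) : bool :=
  [&& cnode P (lam u false) (lam u true), cedge P (lam (at_ u (-1)) true) (lam u false),
      cedge P (lam u true) (lam (at_ u 1) false) &
      (smallinfo n R == None) ==> (C (lam u false) && C (lam u true))].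

Lemma restrictedE n lam : LCLsol restricted n lam <-> forall u, happy lam u.
Proof.
have e u : psi restricted (view R lam u) (smallinfo n R) = happy lam u.
  rewrite /= /restricted_psi /happy.
  have [<- <- <- _] := @ball_labels _ _ id n lam u (view R lam u) (fun _ => erefl).
  by [].
by split=> h u; have := h u; rewrite -?e //= e.
Qed.

Lemma restricted_sub n lam : LCLsol restricted n lam -> NEsol P n lam.
Proof.
by move/restrictedE => h u; have /and4P[h1 _ h2 _] := h u; rewrite cyc1E h1 h2.
Qed.

Lemma restricted_short n lam : n <= R.*2.+1 -> NEsol P n lam -> LCLsol restricted n lam.
Proof.
move=> nR h; apply/restrictedE => u; rewrite /happy /smallinfo nR /= andbT.
have /andP[-> ] := h u; rewrite cyc1E => ->; rewrite andbT /=.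
have /andP[_] := h (at_ u (-1)); rewrite cyc1E at_at.
by have -> : (-1 + 1)%Z = 0%Z by []; rewrite at0.
Qed.

Lemma restricted_long n lam : R.*2.+1 < n -> NEsol P n lam ->
  (forall u b, C (lam u b)) -> LCLsol restricted n lam.
Proof.
move=> nR h hC; apply/restrictedE => u; rewrite /happy !hC implybT andbT.
have /andP[-> ] := h u; rewrite cyc1E => ->; rewrite andbT /=.
have /andP[_] := h (at_ u (-1)); rewrite cyc1E at_at.
by have -> : (-1 + 1)%Z = 0%Z by []; rewrite at0.
Qed.

(** Every label present is replaced by that of one fixed solution, which is a local change as the
    cycle has bounded length. *)
Lemma mend_short n (lam : 'I_n -> option (bool -> gam P)) sol v : n <= R.*2.+1 -> NEsol P n sol ->
  exists mu, is_mend restricted R.*2.+1 lam v mu.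
Proof.
move=> nR hs; pose mu u := if isSome (lam u) || (u == v) then Some (sol u) else None.
have ss := restricted_short nR hs.
exists mu; split; rewrite /mu.
- move=> u f hf; suff -> : f = view R sol u by exact: ss.
  apply: functional_extensionality => k; have := hf k; rewrite /view.
  by case: ifP => // _ [].
- by rewrite eqxx orbT.
- by move=> u; case: (lam u).
- by move=> u _; apply: leq_trans (ltnW (cdist_lt _ _)) nR.
Qed.

(** * Mending on long cycles *)

Section Long.
Variables (K n : nat) (lam : 'I_n -> option (bool -> gam P)) (v : 'I_n).
Hypotheses (gC : good P C K) (KR : K <= R) (nR : R.*2.+1 < n).
Hypothesis acc : accepted restricted lam.

Lemma accepted_happy u : (forall d, (Z.abs d <= Z.of_nat R)%Z -> lam (at_ u d) <> None) ->
  exists l c s, [/\ lam (at_ u (-1)) = Some l, lam u = Some c, lam (at_ u 1) = Some s &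
    [/\ cnode P (c false) (c true), cedge P (l true) (c false), cedge P (c true) (s false) &
      forall b, C (c b)]].
Proof.
move=> full.
have [f hf] : exists f : 'I_(R.*2.+1) -> bool -> gam P, forall k : 'I_(R.*2.+1),
    lam (cyc u k R) = Some (f k).
  have [c _] : exists c, lam u = Some c.
    by have := full 0%Z ltac:(lia); rewrite at0; case: (lam u) => // c; exists c.
  exists (fun k => odflt c (lam (cyc u k R))) => k.
  have := full (Z.of_nat k - Z.of_nat R)%Z ltac:(have := ltn_ord k; lia).
  by rewrite -cycE; case: (lam _).
have := acc hf; have [-> -> -> _] := @ball_labels _ _ Some n lam u f hf.
rewrite /= /restricted_psi /smallinfo leqNgt nR /= => /and4P[h1 h2 h3 /andP[h4 h5]].
by exists (f (inord r)), (f (inord R)), (f (inord r.+2)); split=> //; split=> // -[].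
Qed.

(* Scanning from [v] in direction [e]: either the labelled run ends within the
   window, and all of it may be relabelled, or it is so long that the node at
   distance [R + 1] is verified and its label can be kept. *)
Lemma extent e : (Z.abs e = 1)%Z -> exists a o,
  [/\ a <= R.*2, lam (at_ v (e * Z.of_nat a.+1)) = o,
      forall i, 0 < i <= a -> lam (at_ v (e * Z.of_nat i)) <> None &
      forall l, o = Some l -> a = R /\ forall b, C (l b)].
Proof.
move=> e1; pose h i := ~~ isSome (lam (at_ v (e * Z.of_nat i.+1))).
have [hh|nh] := boolP (has h (iota 0 R.*2.+1)).
  set a := find h (iota 0 R.*2.+1).
  have la : a < R.*2.+1 by move: hh; rewrite has_find size_iota.
  exists a, None; split=> //.
    by have := nth_find 0 hh; rewrite nth_iota // add0n /h; case: (lam _).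
  move=> i /andP[i0 ia]; have ia' : i.-1 < a by lia.
  have := before_find 0 ia'; rewrite nth_iota; last by lia.
  by rewrite add0n /h prednK //; case: (lam _).
have full i : 0 < i <= R.*2.+1 -> lam (at_ v (e * Z.of_nat i)) <> None.
  move=> ib; move/hasPn: nh => /(_ i.-1); rewrite mem_iota /h prednK; last by lia.
  by case: (lam _) => // nh _; have := nh ltac:(lia).
have [|l [c [s [_ cE _ [_ _ _ Cc]]]]] := @accepted_happy (at_ v (e * Z.of_nat R.+1)).
  move=> d dR; rewrite at_at.
  have -> : (e * Z.of_nat R.+1 + d = e * Z.of_nat (Z.to_nat (Z.of_nat R.+1 + e * d)))%Z by nia.
  by apply: full; nia.
exists R, (Some c); split=> //; first by lia.
- by move=> i ib; apply: full; lia.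
- by move=> _ [<-].
Qed.

Lemma mend_long : lam v = None -> exists mu, is_mend restricted R.*2.+1 lam v mu.
Proof.
move=> lv.
have [a [ol [aR olE lfull lkeep]]] := @extent (-1)%Z erefl.
have [b [or [bR orE rfull rkeep]]] := @extent 1%Z erefl.
have [[x0 Cx0] _] := gC.
pose m := (a + b).+1.
have N0 : at_ v (- Z.of_nat a.+1) = at_ v (Z.of_nat n - Z.of_nat a.+1).
  by rewrite -(at_addn v (- Z.of_nat a.+1) 1); congr (at_ v _); lia.
(* The relabelled window does not wrap around: two kept ends give m = 2R + 1 < n, and an empty end
   would otherwise lie in the labelled run on the other side. *)
have mn : m < n.
  rewrite ltnNge; apply/negP => nm.
  case El : ol olE => [l|] olE.
    have [ea _] := lkeep _ El.
    case Er : or orE => [l'|] orE; first by have [eb _] := rkeep _ Er; rewrite /m in nm; lia.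
    have := lfull (n - b.+1) ltac:(rewrite /m in nm; lia).
    have -> : at_ v (-1 * Z.of_nat (n - b.+1)) = at_ v (1 * Z.of_nat b.+1).
      by rewrite -(at_addn v (-1 * _) 1); congr (at_ v _); rewrite /m in nm; lia.
    by rewrite orE.
  have := rfull (n - a.+1) ltac:(rewrite /m in nm; lia).
  have -> : at_ v (1 * Z.of_nat (n - a.+1)) = at_ v (-1 * Z.of_nat a.+1).
    by rewrite -(at_addn v (1 * _) (-1)); congr (at_ v _); rewrite /m in nm; lia.
  by rewrite olE.
have [f [f0 fm fe fn fC]] : exists f : nat -> bool -> gam P,
  [/\ forall l, ol = Some l -> f 0 true = l true,
      forall l, or = Some l -> f m.+1 false = l false,
      forall i, i <= m -> cedge P (f i true) (f i.+1 false),
      forall i, 0 < i <= m -> cnode P (f i false) (f i true) &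
      forall i b, 0 < i <= m -> C (f i b)].
  pose x := if ol is Some l then l true else x0.
  pose y := if or is Some l then l false else x0.
  have Cx : C x by rewrite /x; case: (ol) lkeep => // l h; have [_] := h l erefl.
  have Cy : C y by rewrite /y; case: (or) rkeep => // l h; have [_] := h l erefl.
  (* A kept right end forces b = R, so m is large enough. If that end is empty, a filler longer by K
     is cut off after m nodes. *)
  pose m' := if or is Some _ then m else m + K.
  have mm' : m <= m' by rewrite /m'; case: (or) => // *; apply: leq_addr.
  have Km' : K <= m'.
    rewrite /m'; case: (or) rkeep => [l|] h; last exact: leq_addl.
    by have [eb _] := h l erefl; rewrite /m; lia.
  have [f [f0 fm fe fn fC]] := filler_exists gC Cx Cy Km'.
  exists f; split=> [l E|l E|i im|i im|i b' im].
  - by rewrite f0 /x E.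
  - by move: fm; rewrite /m' /y E.
  - by apply: fe; lia.
  - by apply: fn; lia.
  - by apply: fC; lia.
pose idx (u : 'I_n) := Z.to_nat ((Z.of_nat u - Z.of_nat v + Z.of_nat a) mod Z.of_nat n).
pose mu u := if idx u < m then Some (f (idx u).+1) else lam u.
have idxE z : (- Z.of_nat a <= z < Z.of_nat n - Z.of_nat a)%Z ->
    idx (at_ v z) = Z.to_nat (z + Z.of_nat a).
  move=> hz; have [k ek] := at_val v z; rewrite /idx ek; congr Z.to_nat.
  have -> : (Z.of_nat v + z + k * Z.of_nat n - Z.of_nat v + Z.of_nat a =
    z + Z.of_nat a + k * Z.of_nat n)%Z by lia.
  by rewrite Z_mod_plus_full Z.mod_small //; lia.
have muI z : (- Z.of_nat a <= z <= Z.of_nat b)%Z ->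
    mu (at_ v z) = Some (f (Z.to_nat (z + Z.of_nat a)).+1).
  move=> hz; rewrite /mu idxE; last by rewrite /m in mn; lia.
  by have -> : Z.to_nat (z + Z.of_nat a) < m by rewrite /m; lia.
have muO z : (Z.of_nat b < z < Z.of_nat n - Z.of_nat a)%Z -> mu (at_ v z) = lam (at_ v z).
  move=> hz; rewrite /mu idxE; last by lia.
  by have -> : (Z.to_nat (z + Z.of_nat a) < m) = false by rewrite /m; lia.
have muL : mu (at_ v (- Z.of_nat a.+1)) = ol.
  rewrite N0 muO -?N0; last by rewrite /m in mn; lia.
  by rewrite -olE; congr (lam (at_ v _)); lia.
have muR : mu (at_ v (Z.of_nat b.+1)) = or.
  rewrite muO; last by rewrite /m in mn; lia.
  by rewrite -orE; congr (lam (at_ v _)); lia.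
exists mu; split.
- move=> u g hg.
  have [z hz eu] := at_surj v u (- Z.of_nat a); subst u.
  have [hl hc hr full] := @ball_labels _ _ Some n mu (at_ v z) g hg.
  rewrite !at_at in hl hr.
  rewrite /= /restricted_psi /smallinfo leqNgt nR /=.
  move: (g (inord r)) (g (inord r.+1)) (g (inord r.+2)) hl hc hr => gl gc gr hl hc hr.
  have [zb|zb] := Z_le_gt_dec z (Z.of_nat b).
    have [i ei] : exists i, Z.of_nat i = (z + Z.of_nat a)%Z by exists (Z.to_nat (z + Z.of_nat a)); lia.
    have im : i < m by rewrite /m; lia.
    move: hc; rewrite muI -?ei ?Nat2Z.id; last by lia.
    move=> -[<-]; rewrite fn ?fC //=; apply/and3P; split=> //.
      have [i0|i0] := posnP i.
        move: hl; have -> : (z + -1 = - Z.of_nat a.+1)%Z by lia.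
        by rewrite muL i0 => /f0 <-; apply: fe.
      move: hl; rewrite muI; last by lia.
      have -> : Z.to_nat (z + -1 + Z.of_nat a) = i.-1 by lia.
      by rewrite prednK // => -[<-]; apply: fe; apply: ltnW.
    have [eb|nb] := Z.eq_dec z (Z.of_nat b).
      move: hr; have -> : (z + 1 = Z.of_nat b.+1)%Z by lia.
      rewrite muR => /fm <-; have -> : m = i.+1 by rewrite /m; lia.
      by apply: fe.
    move: hr; rewrite muI; last by lia.
    have -> : Z.to_nat (z + 1 + Z.of_nat a) = i.+1 by lia.
    by move=> -[<-]; apply: fe.
  (* A node outside the window with a fully labelled ball is more than R away from [v]: otherwise
     its ball would contain an end of the window, which is labelled only if it is at distance R + 1.
     Hence its ball was already fully labelled by [lam]. *)
  have farR : (Z.of_nat R < z)%Z.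
    have [//|zR] := Z_lt_le_dec (Z.of_nat R) z.
    have [y] := full (Z.of_nat b.+1 - z)%Z ltac:(lia).
    rewrite at_at; have -> : (z + (Z.of_nat b.+1 - z) = Z.of_nat b.+1)%Z by lia.
    by rewrite muR => /rkeep[eb _]; lia.
  have farL : (z < Z.of_nat n - Z.of_nat R)%Z.
    have [//|zR] := Z_lt_le_dec z (Z.of_nat n - Z.of_nat R).
    have [y] := full (Z.of_nat n - Z.of_nat a.+1 - z)%Z ltac:(lia).
    rewrite at_at.
    have -> : (z + (Z.of_nat n - Z.of_nat a.+1 - z) = Z.of_nat n - Z.of_nat a.+1)%Z by lia.
    by rewrite -N0 muL => /lkeep[ea _]; lia.
  have [|l [c [s [lE cE sE [nc elc ecs Cc]]]]] := @accepted_happy (at_ v z).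
    move=> d dR; rewrite at_at; have [y0 [y1 y2]] : exists y, (z + d = y)%Z /\ (0 < y < Z.of_nat n)%Z.
      by exists (z + d)%Z; lia.
    rewrite y1; have [yb|yb] := Z_le_gt_dec y0 (Z.of_nat b).
      have -> : y0 = (1 * Z.of_nat (Z.to_nat y0))%Z by lia.
      by apply: rfull; lia.
    have [ya|ya] := Z_lt_le_dec y0 (Z.of_nat n - Z.of_nat a).
      have [y] := full d dR; rewrite at_at y1 muO; last by lia.
      by move=> ->.
    have -> : at_ v y0 = at_ v (-1 * Z.of_nat (Z.to_nat (Z.of_nat n - y0))).
      by rewrite -(at_addn v y0 (-1)); congr (at_ v _); lia.
    by apply: lfull; lia.
  rewrite !at_at in lE sE.
  move: (hc); rewrite muO ?cE; last by lia.
  move=> -[ec]; subst c; rewrite nc !Cc /= andbT; apply/andP; split.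
    have [eb|nb] := Z.eq_dec z (Z.of_nat b.+1).
      move: hc; rewrite eb muR => /fm <-.
      move: hl; have -> : (z + -1 = Z.of_nat b)%Z by lia.
      rewrite muI; last by lia.
      have -> : (Z.to_nat (Z.of_nat b + Z.of_nat a)).+1 = m by rewrite /m; lia.
      by move=> -[<-]; apply: fe.
    by move: hl; rewrite muO ?lE; [move=> -[<-] | lia].
  have [eb|nb] := Z.eq_dec z (Z.of_nat n - Z.of_nat a.+1).
    move: hc; rewrite eb -N0 muL => /f0 <-.
    move: hr; have -> : at_ v (z + 1) = at_ v (- Z.of_nat a).
      by rewrite -(at_addn v (- _) 1); congr (at_ v _); lia.
    rewrite muI; last by lia.
    have -> : Z.to_nat (- Z.of_nat a + Z.of_nat a) = 0 by lia.
    by move=> -[<-]; apply: fe.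
  by move: hr; rewrite muO ?sE; [move=> -[<-] | lia].
- by rewrite -{1}[v]at0 muI //; lia.
- by move=> u; rewrite /mu; case: ifP.
move=> u; have [z hz ->] := at_surj v u (- Z.of_nat a).
have [zb|zb] := Z_le_gt_dec z (Z.of_nat b); last by rewrite muO //; lia.
by move=> _; apply: leq_trans (cdist_at _ _) _; lia.
Qed.
End Long.
End Restriction.

(** * Complexity *)

(** The nodes know n, so a rule may be chosen separately for each n; below 3 it is constantly
    [d]. *)
Lemma solvable_pointwise (S : Type) (d : S) (Sol : forall n, ('I_n -> bool -> S) -> Prop) c T :
  (forall n, 3 <= n -> exists run : ('I_((T n).*2.+1) -> nat) -> bool -> S,
     (forall f b, run (fun k => f (rev_ord k)) b = run f (~~ b)) /\
     forall id : 'I_n -> nat, valid_ids c n id -> Sol n (fun v => run (view (T n) id v))) ->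
  solvable Sol c T.
Proof.
move=> h.
have h' n : {run : ('I_((T n).*2.+1) -> nat) -> bool -> S |
     (forall f b, run (fun k => f (rev_ord k)) b = run f (~~ b)) /\
     (3 <= n -> forall id : 'I_n -> nat, valid_ids c n id ->
        Sol n (fun v => run (view (T n) id v)))}.
  apply: constructive_indefinite_description.
  have [n3|n3] := leqP 3 n; last by exists (fun _ _ => d).
  by have [run [h1 h2]] := h n n3; exists run.
exists {| run := fun n => proj1_sig (h' n); run_refl := fun n => (proj2_sig (h' n)).1 |}.
by move=> n n3 id vid; apply: (proj2_sig (h' n)).2.
Qed.

Lemma distinct_ids c n (id : 'I_n -> nat) v D : valid_ids c n id -> D < n ->
  distinct D (fun i => id (at_ v i)).
Proof. by case=> inj _ Dn i j ij /inj /at_inj h; have := h ltac:(lia); lia. Qed.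

(** Common end of the three cases: [U] bounds the rounds of the restricted problem on long cycles,
    and the last hypothesis makes [U] a lower bound for [P] up to a constant factor. *)
Lemma mendable_restriction P (C : pred (gam P)) K c (T0 U : nat -> nat) D :
  0 < c -> symmetricNE P -> good P C K -> solvable (NEsol P) c T0 ->
  (forall n, 0 < n -> exists F, [/\ local (U n) F, equivariant F &
     forall s, distinct D s -> (forall i, s i < n ^ c) -> correct C F s]) ->
  (forall T1, solvable (NEsol P) c T1 -> bigO U T1) ->
  exists P' : LCL (gam P),
    same_complexity (NEsol P) (LCLsol P') c /\
    (forall n, 3 <= n -> forall lam : 'I_n -> bool -> gam P,
        LCLsol P' n lam -> NEsol P n lam) /\
    O1_mendable P'.
Proof.
move=> c0 symP gC [A0 sA0] hF hU.
(* This radius ensures K <= R for mending, and on long cycles D < n, so that identifiers are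
   distinct up to distance D. *)
pose r := K + D; pose R := r.+1.
exists (restricted symP C r); split; [|split].
- move=> T; split=> -[T1 [T1T [A1 sA1]]]; last first.
    by exists T1; split=> //; exists A1 => n n3 id vid; apply: restricted_sub (sA1 n n3 id vid).
  pose T2 n := if n <= R.*2.+1 then T1 n else U n.
  exists T2; split.
    have [c1 [N1 h1]] := hU T1 (ex_intro _ A1 sA1); have [c2 [N2 h2]] := T1T.
    exists (c1 * c2 + c2), (N1 + N2) => n nN; rewrite /T2.
    have l1 := h1 n ltac:(lia); have l2 := h2 n ltac:(lia).
    case: ifP => _; first by nia.
    apply: leq_trans l1 _; apply: (@leq_trans (c1 * (c2 * T n))); first by rewrite leq_mul2l l2 orbT.
    by rewrite mulnDl mulnA leq_addr.
  have [[x0 _] _] := gC.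
  apply: (@solvable_pointwise _ x0 (fun n => LCLsol (restricted symP C r) n)) => n n3; rewrite /T2.
  case: (leqP n R.*2.+1) => nR.
    exists (run A1 n); split; first by move=> f b; apply: run_refl.
    by move=> id vid; apply: restricted_short => //; apply: sA1.
  have [F [lF eF cF]] := hF n ltac:(lia).
  have [run [rr rE]] := run_of_local lF eF.
  exists run; split=> // id vid.
  have ok v : correct C F (fun i => id (at_ v i)).
    apply: cF; last by move=> i; apply: vid.2.
    by apply: distinct_ids vid _; rewrite /R /r in nR; lia.
  apply: restricted_long => // [v|v b]; rewrite !rE.
    have [_ -> he] := ok v; rewrite cyc1E; move: he; congr (is_true (cedge P _ (F _ _))).
    by apply: functional_extensionality => i; rewrite at_at.
  by have [h _ _] := ok v.
- by move=> n n3 lam; apply: restricted_sub.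
exists (restricted symP C r); split=> //; exists R.*2.+1 => n n3 lam acc v.
case lv : (lam v) => [l|].
  by exists lam; split=> //; rewrite lv.
have [nR|nR] := leqP n R.*2.+1; last by apply: mend_long gC _ nR acc lv; rewrite /R /r; lia.
(* The node numbers serve as identifiers, with which the given algorithm yields the solution used to
   mend a short cycle. *)
have vid : valid_ids c n (fun v : 'I_n => nat_of_ord v).
  split; first exact: val_inj.
  by move=> u; apply: leq_trans (ltn_ord u) _; rewrite -[X in X <= _]expn1 leq_pexp2l //; lia.
exact: (mend_short symP C lam v nR (sA0 n n3 _ vid)).
Qed.

Lemma positive_rounds P c T : 0 < c -> solvable (NEsol P) c T ->
  ~ (exists x, cnode P x x && cedge P x x) ->
  forall n, #|gam P| + 3 <= n -> 0 < T n.
Proof.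
move=> c0 [A sA] nx n nN; rewrite lt0n; apply/negP => /eqP T0; apply: nx.
have := @alg_window_rule _ _ _ A n c0 sA ltac:(lia) ltac:(lia).
by rewrite T0 => /zero_round_constant; apply; lia.
Qed.

Theorem theoremB2 (P : NELCL) (c : nat) :
  0 < c ->
  symmetricNE P ->
  (exists T, bigO T logstar /\ solvable (NEsol P) c T) ->
  exists P' : LCL (gam P),
    same_complexity (NEsol P) (LCLsol P') c /\
    (forall n, 3 <= n -> forall lam : 'I_n -> bool -> gam P,
        LCLsol P' n lam -> NEsol P n lam) /\
    O1_mendable P'.
Proof.
move=> c0 symP [T0 [[c1 [N1 hT0]] sT0]].
case: (classic (exists x, cnode P x x && cedge P x x)) => [[x /andP[nx ex]]|noconst].
  pose C := pred1 x.
  have gC : good P C 0.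
    split; first by exists x; apply/eqxx.
    move=> y z m /eqP -> /eqP -> _; exists x; split; rewrite /C /= ?eqxx //.
    by elim: m => //= m IH; exists x, x; split; rewrite ?eqxx.
  apply: (@mendable_restriction P C 0 c T0 (fun _ => 0) 0) => //; last by exists 0, 0.
  move=> n _; exists (fun _ _ => x); split=> // s _ _.
  by split=> [b||] //; rewrite /C /= eqxx.
case: (classic (exists (C : pred (gam P)) K a b,
    [/\ good P C K, C a, C b, cnode P a b & cedge P b a])) => [[C [K [a [b [gC Ca Cb nab eba]]]]]|noloop].
  have [t [D [F [lF eF cF]]]] := loop_algorithm symP gC Ca Cb nab eba.
  apply: (@mendable_restriction P C K c T0 (fun _ => t) D) => //.
    by move=> n _; exists F; split=> // s ds _; apply: cF.
  move=> T1 sT1; exists t, (#|gam P| + 3) => n nN.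
  by have := positive_rounds c0 sT1 noconst nN; apply: leq_pmulr.
(* The bound 6T + 4 leaves room for three windows of 2T + 1 identifiers. *)
have extract T (A : Alg (gam P) T) n : solves (NEsol P) c A -> 3 <= n -> 6 * T n + 4 <= n ->
    window_rule P n (T n) (alg_label A n) /\
    exists K, good P (window_labels P n (T n) (alg_label A n)) K.
  move=> sA n3 nT; have w : window_rule P n (T n) (alg_label A n).
    by apply: alg_window_rule c0 sA n3 _; lia.
  by split=> //; eexists; apply: window_labels_good w _; lia.
have [C [K gC]] : exists C K, good P C K.
  (* Some n past the threshold of the upper bound is large compared with 6 c1 [logstar n], hence
     with six times the radius. *)
  have [n [nN n3 nl]] := logstar_sublinear (6 * c1) N1.
  have [A sA] := sT0; have hn := hT0 n nN.
  have [|_ [K gC]] := @extract T0 A n sA n3; last by exists (window_labels P n (T0 n) (alg_label A n)), K.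
  by lia.
have [t [D hF]] := colour_algorithm c symP gC.
apply: (@mendable_restriction P C K c T0 (fun n => t + t * logstar n) D) => //.
move=> T1 [A sA]; exists (t * (12 + #|gam P|)), (#|gam P| + 3) => n nN.
have T1n := positive_rounds c0 (ex_intro _ A sA) noconst nN.
(* Since T1 n is positive, the additive constants are absorbed into the factor. *)
suff : logstar n <= 6 * T1 n + 4 + #|gam P| by nia.
(* If n is too short for the windows, [logstar n <= n] already gives the bound. *)
have [nT|nT] := leqP (6 * T1 n + 4) n; last first.
  by have := logstar_rec_le n n; rewrite -/(logstar n); lia.
have [w [K' gC']] := @extract T1 A n sA ltac:(lia) nT.
suff : logstar n <= (T1 n).*2 + #|gam P| by lia.
apply: loopless_logstar w _ => a b Ca Cb; apply/negP => /andP[nab eba].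
by apply: noloop; exists (window_labels P n (T1 n) (alg_label A n)), K', a, b.
Qed.
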